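(* Let $X$ be a locally compact Hausdorff space, let $\mathcal{Q}\neq\{0\}$ be a separable Hilbert space over $\mathbb{F}\in\{\mathbb{R},\mathbb{C}\}$, and let $K:X\times X\to\mathbb{F}$ be a $\mathcal{C}_0$-kernel. 1. Given POVMs $\mu,\nu\in\mathscr{P}(X,\mathcal{Q})$, $$T_K^{\mu}=T_K^{\nu}\iff T_K^{\mu_{\rho}}=T_K^{\nu_{\rho}}\ \text{ for every density operator }\rho\text{ on }\mathcal{Q}.$$ 2. $K$ is characteristic for $\mathscr{P}(X,\mathcal{Q})$ if and only if it is characteristic for $\mathscr{P}(X)$.
   Context: Inner products are linear in the first argument. A kernel is a positive definite function $K:X\times X\to\mathbb{F}$ (finite Gram matrices non-negative definite) with reproducing kernel Hilbert space $\mathcal{R}(K)$ (assumed separable); it is a $\mathcal{C}_0$-kernel if $\sup_x K(x,x)<\infty$ and $K(\cdot,x)\in\mathcal{C}_0(X)$ for all $x$. A POVM is a map $\nu$ from the Borel sets of $X$ to non-negative definite bounded operators on $\mathcal{Q}$ with $\nu(\emptyset)=0$, $\nu(X)=I_{\mathcal{Q}}$, countably additive in the strong operator topology; $\mathscr{P}(X,\mathcal{Q})$ is the set of POVMs, and $\mathscr{P}(X)=\mathscr{P}(X,\mathbb{F})$ is the set of Borel probability measures on $X$. Put $\nu_{\phi,\psi}(B)=\langle\nu(B)\phi,\psi\rangle$. A density operator $\rho$ is a non-negative definite trace-class operator on $\mathcal{Q}$ with trace $1$; it induces the probability measure $\nu_\rho(B)=\mathrm{Tr}[\rho\,\nu(B)]$.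 The quantum covariance embedding (QCE) of $\nu\in\mathscr{P}(X,\mathcal{Q})$ is the unique bounded operator $T_K^{\nu}$ on $\mathcal{R}(K)\otimes\mathcal{Q}$ with $\langle T_K^{\nu}(f\otimes\phi),g\otimes\psi\rangle=\int_X f\overline{g}\,d\nu_{\phi,\psi}$ for all $f,g\in\mathcal{R}(K)$, $\phi,\psi\in\mathcal{Q}$. For a probability measure $P\in\mathscr{P}(X)$ (the case $\mathcal{Q}=\mathbb{F}$), $T_K^{P}$ is the operator on $\mathcal{R}(K)$ with $\langle T_K^{P}f,g\rangle=\int_X f\overline{g}\,dP$. $K$ is characteristic for $\mathscr{P}(X,\mathcal{Q})$ (resp. $\mathscr{P}(X)$) if $\nu\mapsto T_K^{\nu}$ is injective on $\mathscr{P}(X,\mathcal{Q})$ (resp. on $\mathscr{P}(X)$). *)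

(* Defs.v *)
From HB Require Import structures.
From mathcomp Require Import all_boot all_order all_algebra.
From mathcomp Require Import all_classical all_reals all_analysis.
From mathcomp Require Import complex ring.
Set Implicit Arguments.
Unset Strict Implicit.
Unset Printing Implicit Defensive.
Import Order.TTheory GRing.Theory Num.Theory.
Import numFieldNormedType.Exports.
Local Open Scope classical_set_scope.
Local Open Scope ring_scope.

Variant scalar_kind := RealScalars | ComplexScalars.

Definition scalars (R : realType) (k : scalar_kind) : numFieldType :=
  match k with
  | RealScalars => R
  | ComplexScalars => R[i]
  end.

Section Scalars.
Context {R : realType} {k : scalar_kind}.

Definition conjs : {rmorphism scalars R k -> scalars R k} :=
  match k return {rmorphism scalars R k -> scalars R k} with
  | RealScalars => idfun
  | ComplexScalars => Num.conj
  end.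

Definition res : scalars R k -> R :=
  match k return scalars R k -> R with
  | RealScalars => idfun
  | ComplexScalars => @complex.Re R
  end.

Definition ims : scalars R k -> R :=
  match k return scalars R k -> R with
  | RealScalars => fun=> 0
  | ComplexScalars => @complex.Im R
  end.

(* a + i b; over the real field the second component is ignored. *)
Definition mks (a b : R) : scalars R k :=
  match k return scalars R k with
  | RealScalars => a
  | ComplexScalars => (a +i* b)%C
  end.

Lemma resD x y : res (x + y) = res x + res y.
Proof. by rewrite /res; case: k x y => [//|] [a b] [c d]. Qed.

Lemma imsD x y : ims (x + y) = ims x + ims y.
Proof. by rewrite /ims; case: k x y => [x y|[a b] [c d]//]; rewrite addr0. Qed.

Lemma res0 : res 0 = 0. Proof. by rewrite /res; case: k. Qed.

Lemma ims0 : ims 0 = 0. Proof. by rewrite /ims; case: k. Qed.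

End Scalars.

Section ScalarTopology.
Context {R : realType} {k : scalar_kind}.

Lemma le_parts (x e : scalars R k) :
  `|x| < e -> `|res x| < res e /\ `|ims x| < res e.
Proof.
rewrite /res /ims; case: k x e => /= [x e xe|[a b] [c d]].
  by split=> //; rewrite normr0 (le_lt_trans _ xe).
rewrite normc_def ltcE /= => /andP[_ abc]; split; apply: le_lt_trans abc.
  by rewrite -sqrtr_sqr ler_wsqrtr// lerDl sqr_ge0.
by rewrite -sqrtr_sqr ler_wsqrtr// lerDr sqr_ge0.
Qed.

Lemma mks_gt0 (e : R) : 0 < e -> (0 : scalars R k) < mks e 0.
Proof. by rewrite /mks; case: k => //= e0; rewrite ltcE /= eqxx. Qed.

Lemma res_mks (a b : R) : res (mks a b : scalars R k) = a.
Proof. by rewrite /res /mks; case: k. Qed.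

Lemma cvg_parts (u : nat -> scalars R k) (l : scalars R k) :
  u @ \oo --> l -> (res \o u) @ \oo --> res l /\ (ims \o u) @ \oo --> ims l.
Proof.
have resB (x y : scalars R k) : res (x - y) = res x - res y.
  by apply: (addIr (res y)); rewrite -resD !subrK.
have imsB (x y : scalars R k) : ims (x - y) = ims x - ims y.
  by apply: (addIr (ims y)); rewrite -imsD !subrK.
move=> /cvgrPdist_lt ul; split; apply/cvgrPdist_lt => e e0;
  near=> n; rewrite /= -?resB -?imsB;
  suff /le_parts[]: `|l - u n| < mks e 0 by rewrite res_mks.
all: by near: n; exact/ul/mks_gt0.
Unshelve. all: by end_near. Qed.

End ScalarTopology.

(* The form is linear in its first argument and conjugate-linear in the
   second. *)
Record hilbertType (R : realType) (k : scalar_kind) := HilbertType {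
  hilbert_sort :> completeNormedModType (scalars R k) ;
  inner : {dot hilbert_sort for @conjs R k} ;
  inner_norm : forall x : hilbert_sort, `|x| ^+ 2 = inner x x }.

Section Hilbert.
Context {R : realType} {k : scalar_kind} (H : hilbertType R k).
Local Notation F := (scalars R k).

Definition separable_space := exists2 D : set H, countable D & dense D.

Definition linear_span (S : set H) : set H :=
  [set u | exists n (c : 'I_n -> F) (s : 'I_n -> H),
     (forall i, S (s i)) /\ u = \sum_(i < n) c i *: s i].

Definition bounded_operator (T : H -> H) :=
  linear T /\ exists M : F, forall x, `|T x| <= M * `|x|.

(* Self-adjointness is required explicitly: over the reals it does not follow
   from the positivity of the quadratic form. *)
Definition nonneg_operator (T : H -> H) :=
  [/\ bounded_operator T,
      forall x y, inner H (T x) y = inner H x (T y) &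
      forall x, 0 <= inner H (T x) x].

(* Zero vectors are allowed, so that the Hilbert bases of finite-dimensional
   spaces are also indexed by nat (the nonzero e i are the actual basis). *)
Definition orthonormal_basis (e : nat -> H) :=
  [/\ forall i, e i = 0 \/ `|e i| = 1,
      forall i j, i != j -> inner H (e i) (e j) = 0 &
      dense (linear_span (range e))].

Definition trace_series (A : H -> H) (e : nat -> H) : F ^nat :=
  fun n => \sum_(i < n) inner H (A (e i)) (e i).

Definition trace (A : H -> H) : F :=
  xget 0 [set t | forall e, orthonormal_basis e ->
                    trace_series A e @ \oo --> t].

(* absA is |A|, the nonnegative square root of A^* A. *)
Definition trace_class (A : H -> H) :=
  bounded_operator A /\
  exists absA : H -> H,
    [/\ nonneg_operator absA,
        forall x y, inner H (absA x) (absA y) = inner H (A x) (A y) &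
        exists2 e, orthonormal_basis e & cvgn (trace_series absA e)].

Definition density_operator (rho : H -> H) :=
  [/\ nonneg_operator rho, trace_class rho & trace rho = 1].

End Hilbert.

Section InnerContinuity.
Context {R : realType} {k : scalar_kind} (H : hilbertType R k).
Local Notation F := (scalars R k).

Lemma mul_conjs (z : F) : z * conjs z = `|z| ^+ 2.
Proof.
rewrite /conjs; case: k z => /= [x|z]; last by rewrite normCK.
by rewrite -normrX ger0_norm ?sqr_ge0// expr2.
Qed.

Lemma innerC (x y : H) : inner H x y = conjs (inner H y x).
Proof. by rewrite hermitian_subproof expr0 mul1r. Qed.

Lemma innerBl (x y z : H) : inner H (x - y) z = inner H x z - inner H y z.
Proof. exact: linearBl. Qed.

Lemma innerDl (x y z : H) : inner H (x + y) z = inner H x z + inner H y z.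
Proof. by rewrite -{2}(addrK y x) innerBl subrK. Qed.

Lemma innerZl (a : F) (x y : H) : inner H (a *: x) y = a * inner H x y.
Proof. exact: linearZl_LR. Qed.

Lemma innerBr (x y z : H) : inner H z (x - y) = inner H z x - inner H z y.
Proof. by rewrite innerC innerBl rmorphB/= -!innerC. Qed.

Lemma innerZr (a : F) (x y : H) : inner H y (a *: x) = conjs a * inner H y x.
Proof. by rewrite innerC innerZl rmorphM/= -innerC. Qed.

Lemma inner0l (y : H) : inner H 0 y = 0.
Proof. by rewrite -(scale0r (0 : H)) innerZl mul0r. Qed.

Lemma cauchy_schwarz (x y : H) : `|inner H x y| <= `|x| * `|y|.
Proof.
have [->|y0] := eqVneq y 0.
  by rewrite innerC inner0l rmorph0 !normr0 mulr0.
have s0 : 0 < `|y| ^+ 2 by rewrite exprn_gt0// normr_gt0.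
set s := `|y| ^+ 2 in s0 *; set a := inner H x y.
have sE : inner H y y = s by rewrite -inner_norm.
have cs : conjs s = s by rewrite -sE -innerC.
have : 0 <= `|s *: x - a *: y| ^+ 2 by rewrite exprn_ge0.
rewrite inner_norm innerBl !innerBr !innerZl !innerZr sE cs -inner_norm.
rewrite (innerC y x) -/a.
rewrite (_ : _ - _ = s * (s * `|x| ^+ 2 - a * conjs a)); last first.
  ring.
rewrite pmulr_rge0// subr_ge0 mul_conjs mulrC -exprMn.
by rewrite ler_pXn2r// nnegrE mulr_ge0.
Qed.

Lemma inner_cvg (u : nat -> H) (l y : H) :
  u @ \oo --> l -> (fun n => inner H (u n) y) @ \oo --> inner H l y.
Proof.
move=> /cvgrPdist_lt ul; apply/cvgrPdist_lt => e e0.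
have y1 : 0 < `|y| + 1 by rewrite ltr_wpDl.
near=> n; rewrite -innerBl (le_lt_trans (cauchy_schwarz _ _))//.
apply: (@le_lt_trans _ _ (`|l - u n| * (`|y| + 1))).
  by rewrite ler_wpM2l// lerDl.
rewrite -ltr_pdivlMr//.
by near: n; apply: ul; rewrite divr_gt0.
Unshelve. all: by end_near. Qed.

End InnerContinuity.

(* The Hilbert space tensor product, up to unitary equivalence. *)
Record hilbert_tensor (R : realType) (k : scalar_kind) (H Q : hilbertType R k) :=
  HilbertTensor {
  tensor_space :> hilbertType R k ;
  tensor : H -> Q -> tensor_space ;
  tensor_linearl : forall y, linear (tensor ^~ y) ;
  tensor_linearr : forall x, linear (tensor x) ;
  tensor_inner : forall x x' y y',
    inner tensor_space (tensor x y) (tensor x' y') =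
    inner H x x' * inner Q y y' ;
  tensor_dense : dense (linear_span [set tensor p.1 p.2 | p in [set: H * Q]]) }.

Section Kernels.
Context {R : realType} {k : scalar_kind} {X : ptopologicalType}.
Local Notation F := (scalars R k).

Definition positive_definite_kernel (K : X -> X -> F) :=
  (forall x y, K y x = conjs (K x y)) /\
  forall n (x : 'I_n -> X) (c : 'I_n -> F),
    0 <= \sum_(i < n) \sum_(j < n) conjs (c i) * K (x i) (x j) * c j.

Definition vanishing_continuous (f : X -> F) :=
  continuous f /\
  forall e : F, 0 < e ->
    exists2 A : set X, compact A & forall x, ~ A x -> `|f x| < e.

Definition C0_kernel (K : X -> X -> F) :=
  [/\ positive_definite_kernel K,
      exists M : F, forall x, K x x <= M &
      forall x, vanishing_continuous (K ^~ x)].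

(* The Hilbert space of functions on X (rkhs_eval f being f as a function)
   with reproducing kernel K; it is unique up to an isometry preserving
   rkhs_eval. *)
Record rkhs (K : X -> X -> F) := RKHS {
  rkhs_space :> hilbertType R k ;
  rkhs_eval : rkhs_space -> X -> F ;
  rkhs_section : X -> rkhs_space ;
  rkhs_eval_linear : forall x, linear_for *%R (rkhs_eval ^~ x) ;
  rkhs_eval_inj : injective rkhs_eval ;
  rkhs_sectionE : forall x, rkhs_eval (rkhs_section x) = K ^~ x ;
  rkhs_reproducing : forall f x,
    rkhs_eval f x = inner rkhs_space f (rkhs_section x) }.

End Kernels.


Section Povm.
Context {R : realType} {k : scalar_kind} (X : ptopologicalType).
Variable Q : hilbertType R k.
Local Notation F := (scalars R k).

Definition borel := g_sigma_algebraType (@open X).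

(* Only the values of povm_op at Borel sets are meaningful. *)
Record povm := Povm {
  povm_op :> set borel -> Q -> Q ;
  povm_nonneg : forall B, measurable B -> nonneg_operator (povm_op B) ;
  povm_set0 : forall x, povm_op set0 x = 0 ;
  povm_setT : forall x, povm_op setT x = x ;
  povm_sigma_additive : forall B : nat -> set borel,
    (forall n, measurable (B n)) -> trivIset setT B ->
    forall x, (fun n => \sum_(i < n) povm_op (B i) x) @ \oo -->
              povm_op (\bigcup_n B n) x }.

(* Real and imaginary parts of the scalar measure B |-> <nu(B) x, y>. *)
Definition povm_re (nu : povm) (x y : Q) (B : set borel) : \bar R :=
  (res (inner Q (nu B x) y))%:E.

Definition povm_im (nu : povm) (x y : Q) (B : set borel) : \bar R :=
  (ims (inner Q (nu B x) y))%:E.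

Section PovmCharge.
Variables (nu : povm) (x y : Q).

Let cvg_inner (B : nat -> set borel) :
  (forall n, measurable (B n)) -> trivIset setT B ->
  (fun n => \sum_(i < n) inner Q (nu (B i) x) y) @ \oo -->
  inner Q (nu (\bigcup_n B n) x) y.
Proof.
move=> mB tB; have := inner_cvg (y := y) (@povm_sigma_additive nu _ mB tB x).
under eq_fun => n do rewrite (big_morph (fun z => inner Q z y)
  (fun a b => innerDl a b y) (inner0l y)).
exact.
Qed.

Let re0 : povm_re nu x y set0 = 0%E.
Proof. by rewrite /povm_re povm_set0 inner0l res0. Qed.

Let re_fin B : measurable B -> povm_re nu x y B \is a fin_num.
Proof. by []. Qed.

Let re_sigma : semi_sigma_additive (povm_re nu x y).
Proof.
move=> B mB tB _; rewrite /povm_re.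
under eq_fun => n do rewrite sumEFin big_mkord.
under [X in X @ _]eq_fun => n do
  rewrite -(big_morph res resD res0).
by apply: cvg_EFin; [exact: nearW|exact: (cvg_parts (cvg_inner mB tB)).1].
Qed.

HB.instance Definition _ := isCharge.Build _ _ _ (povm_re nu x y)
  re0 re_fin re_sigma.

Let im0 : povm_im nu x y set0 = 0%E.
Proof. by rewrite /povm_im povm_set0 inner0l ims0. Qed.

Let im_fin B : measurable B -> povm_im nu x y B \is a fin_num.
Proof. by []. Qed.

Let im_sigma : semi_sigma_additive (povm_im nu x y).
Proof.
move=> B mB tB _; rewrite /povm_im.
under eq_fun => n do rewrite sumEFin big_mkord.
under [X in X @ _]eq_fun => n do
  rewrite -(big_morph ims imsD ims0).
by apply: cvg_EFin; [exact: nearW|exact: (cvg_parts (cvg_inner mB tB)).2].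
Qed.

HB.instance Definition _ := isCharge.Build _ _ _ (povm_im nu x y)
  im0 im_fin im_sigma.

End PovmCharge.
End Povm.

Section Integrals.
Context {d : measure_display} {T : measurableType d} {R : realType}.

Lemma hahn_pair_exists (nu : {charge set T -> \bar R}) :
  exists PN : set T * set T, hahn_decomposition nu PN.1 PN.2.
Proof. by have [P [N PN]] := Hahn_decomposition nu; exists (P, N). Qed.

Definition hahn_pair (nu : {charge set T -> \bar R}) :=
  cid (hahn_pair_exists nu).

(* The Jordan measures do not depend on the chosen Hahn decomposition. *)
Definition charge_integral (nu : {charge set T -> \bar R}) (h : T -> R) : R :=
  \int[jordan_pos (svalP (hahn_pair nu))]_x h x -
  \int[jordan_neg (svalP (hahn_pair nu))]_x h x.

End Integrals.

Section Embedding.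
Context {R : realType} {k : scalar_kind} {X : ptopologicalType}.
Local Notation F := (scalars R k).

(* Integral of h against the scalar measure <nu(.) x, y>. *)
Definition povm_integral (Q : hilbertType R k) (nu : povm X Q) (x y : Q)
    (h : X -> F) : F :=
  mks (charge_integral (povm_re nu x y) (res \o h) -
       charge_integral (povm_im nu x y) (ims \o h))
      (charge_integral (povm_re nu x y) (ims \o h) +
       charge_integral (povm_im nu x y) (res \o h)).

Definition measure_integral (P : set (borel X) -> \bar R) (h : X -> F) : F :=
  mks (fine (integral P setT (EFin \o (res \o h))))
      (fine (integral P setT (EFin \o (ims \o h)))).

Context {K : X -> X -> F} (H : rkhs K).

Definition fprod (f g : H) : X -> F :=
  fun x => rkhs_eval f x * conjs (rkhs_eval g x).

Definition is_qce (Q : hilbertType R k) (HQ : hilbert_tensor H Q)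
    (nu : povm X Q) (T : HQ -> HQ) :=
  bounded_operator T /\
  forall (f g : H) (x y : Q),
    inner HQ (T (tensor HQ f x)) (tensor HQ g y) =
    povm_integral nu x y (fprod f g).

(* The quantum covariance embedding T_K^nu, on H (x) Q. *)
Definition qce (Q : hilbertType R k) (HQ : hilbert_tensor H Q)
    (nu : povm X Q) : HQ -> HQ :=
  xget (fun=> 0) [set T | is_qce nu T].

Arguments qce {Q} HQ nu.

Definition is_qce_prob (P : set (borel X) -> \bar R) (T : H -> H) :=
  bounded_operator T /\
  forall f g : H, inner H (T f) g = measure_integral P (fprod f g).

(* The embedding T_K^P of a probability measure P, on H. *)
Definition qce_prob (P : set (borel X) -> \bar R) : H -> H :=
  xget (fun=> 0) [set T | is_qce_prob P T].

(* nu_rho(B) = Tr[rho nu(B)], which is real since rho and nu(B) are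
   nonnegative. *)
Definition induced_measure (Q : hilbertType R k) (nu : povm X Q)
    (rho : Q -> Q) (B : set (borel X)) : \bar R :=
  (res (trace (rho \o nu B)))%:E.

Definition characteristic_povm (Q : hilbertType R k)
    (HQ : hilbert_tensor H Q) :=
  forall mu nu : povm X Q, qce HQ mu = qce HQ nu ->
    forall B, measurable B -> mu B = nu B.

Definition characteristic_prob :=
  forall P P' : probability (borel X) R, @qce_prob P = @qce_prob P' ->
    forall B, measurable B -> P B = P' B.

End Embedding.

Arguments qce {R k X K H Q} HQ nu _.
Arguments qce_prob {R k X K} H P _.

(* Main.v *)
Require Import Defs.
From HB Require Import structures.
From mathcomp Require Import all_boot all_order all_algebra.
From mathcomp Require Import all_classical all_reals all_analysis.
From mathcomp Require Import measurable_realfun complex ring lra.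
Set Implicit Arguments.
Unset Strict Implicit.
Unset Printing Implicit Defensive.
Import Order.TTheory GRing.Theory Num.Theory.
Import numFieldNormedType.Exports.
Local Open Scope classical_set_scope.
Local Open Scope ring_scope.

(** Approximate the integrals against the complex measures [<nu(.) x, y>] by
    Riemann sums over finite measurable partitions, along the filter of
    refinements.  Linear identities and inequalities between the values [nu B]
    then pass to the integrals.  In particular, for [u = sum_i f_i (x) x_i], the
    Schur product theorem applied to the positive semidefinite matrices
    [M <f_i, f_j> - f_i(t) conj (f_j(t))], where [M >= sup_t K(t, t)], and
    [<nu(B) x_i, x_j>] bounds [sum_ij int f_i conj(f_j) d<nu(.) x_i, x_j>] by
    [M |u|^2]; Riesz representation then yields the embedding [T_K^nu].

    By polarization, [T_K^nu] determines and is determined by the integrals of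
    the functions [f conj(g)] against the positive measures [<nu(.) x, x>], which
    for unit vectors are the measures induced by pure states.  Conversely, a
    density operator [rho] is a sum [sum_n |v_n><v_n|], so that the measure it
    induces is [sum_n <nu(.) v_n, v_n>].  For the second part, a probability [P]
    is turned into the POVM [P(.) I]. *)

(** * Scalars *)

(** [qce] and [qce_prob] are choices with a default value, so an equality between two of them says
    something about integrals only once operators with the defining property exist; this is why the
    Schur and Riesz arguments are required. In the other direction, equal integrals make the two
    defining predicates equal, hence also the chosen operators. The integrals against [<nu(.) x, y>]
    are built from Hahn decompositions that vary with [nu], [x] and [y], so additivity in the
    measure is hidden. A Riemann sum is linear in finitely many operators [nu B]: polarization and
    positivity are checked cell by cell, and the limit no longer mentions Hahn sets. The trace is a
    choice too, of a limit common to all orthonormal bases, so a formula for [Tr[rho nu(B)]] has to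
    be proved in an arbitrary basis. The vectors [v_n] are [rho f_n], where [f] comes from
    Gram-Schmidt for the semi-inner product [<rho x, y>] applied to a dense sequence. *)

Section ScalarTheory.
Context {R : realType} {k : scalar_kind}.
Local Notation F := (scalars R k).

Definition rc (r : R) : F := mks r 0.

Fact rc_is_zmod_morphism : zmod_morphism rc.
Proof.
rewrite /rc /mks => x y; case: k => //=.
by rewrite /GRing.opp /GRing.add/= subr0.
Qed.

Fact rc_is_monoid_morphism : monoid_morphism rc.
Proof.
rewrite /rc /mks; split; case: k => //= x y.
by rewrite /GRing.mul/= !mul0r !mulr0 subr0 addr0.
Qed.

HB.instance Definition _ :=
  GRing.isZmodMorphism.Build R F rc rc_is_zmod_morphism.
HB.instance Definition _ :=
  GRing.isMonoidMorphism.Build R F rc rc_is_monoid_morphism.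

Fact res_is_zmod_morphism : zmod_morphism (res : F -> R).
Proof. by move=> x y; apply: (addIr (res y)); rewrite -resD !subrK. Qed.

Fact ims_is_zmod_morphism : zmod_morphism (ims : F -> R).
Proof. by move=> x y; apply: (addIr (ims y)); rewrite -imsD !subrK. Qed.

HB.instance Definition _ :=
  GRing.isZmodMorphism.Build F R res res_is_zmod_morphism.
HB.instance Definition _ :=
  GRing.isZmodMorphism.Build F R ims ims_is_zmod_morphism.

Lemma rcK r : res (rc r) = r.
Proof. exact: res_mks. Qed.

Lemma ims_rc r : ims (rc r) = 0.
Proof. by rewrite /rc /ims /mks; case: k. Qed.

(** The order of [R[i]] compares only numbers with equal imaginary parts. This lemma moves every
    order argument from [F] to [R]. *)
Lemma rcE (z : F) : 0 <= z -> z = rc (res z).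
Proof.
rewrite /rc /res /mks; case: k z => //= -[a b]; rewrite lecE /=.
by case/andP => /eqP ->.
Qed.

Lemma ler_rc (a b : R) : (rc a <= rc b) = (a <= b).
Proof. by rewrite /rc /mks; case: k => //=; rewrite lecE/= eqxx. Qed.

Lemma ltr_rc (a b : R) : (rc a < rc b) = (a < b).
Proof. by rewrite /rc /mks; case: k => //=; rewrite ltcE/= eqxx. Qed.

Lemma rc_ge0 (a : R) : (0 <= rc a) = (0 <= a).
Proof. by rewrite -(rmorph0 rc) ler_rc. Qed.

Lemma rc_gt0 (a : R) : (0 < rc a) = (0 < a).
Proof. by rewrite -(rmorph0 rc) ltr_rc. Qed.

Lemma norm_rc (a : R) : `|rc a| = rc `|a|.
Proof.
have [a0|a0] := leP 0 a; first by rewrite !ger0_norm// rc_ge0.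
by rewrite ltr0_norm ?(ltr0_norm a0) ?rmorphN// -(rmorph0 rc) ltr_rc.
Qed.

Lemma res_le (x y : F) : x <= y -> res x <= res y.
Proof.
by rewrite -subr_ge0 => xy; rewrite -subr_ge0 -raddfB -rc_ge0 -rcE.
Qed.

Lemma res_ge0 (x : F) : 0 <= x -> 0 <= res x.
Proof. by move=> x0; rewrite -rc_ge0 -rcE. Qed.

Lemma res_gt0 (x : F) : 0 < x -> 0 < res x.
Proof. by move=> x0; rewrite -rc_gt0 -rcE// ltW. Qed.

Lemma norm_rcE (z : F) : `|z| = rc (res `|z|).
Proof. exact: rcE. Qed.

(** [le_parts] treats strict bounds only; were the claim false, it would apply with the bound
    [|res z|] itself and give [|res z| < |res z|]. *)
Lemma res_norm (z : F) : `|res z| <= res `|z|.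
Proof.
rewrite leNgt; apply/negP; rewrite -ltr_rc -norm_rcE.
by move=> /le_parts[+ _]; rewrite rcK ltxx.
Qed.

Lemma ims_norm (z : F) : `|ims z| <= res `|z|.
Proof.
rewrite leNgt; apply/negP; rewrite -ltr_rc -norm_rcE.
by move=> /le_parts[_]; rewrite rcK ltxx.
Qed.

Lemma resM (x y : F) : res (x * y) = res x * res y - ims x * ims y.
Proof.
by rewrite /res /ims; case: k x y => [x y|[a b] [c d]] /=; rewrite ?(mul0r, subr0).
Qed.

Lemma imsM (x y : F) : ims (x * y) = res x * ims y + ims x * res y.
Proof.
by rewrite /res /ims; case: k x y => [x y|[a b] [c d]] /=; rewrite ?(mul0r, mulr0, addr0).
Qed.

Definition imag_unit : F := mks 0 1.

(* Over the reals [mks a b] is [a] and [imag_unit] is [0]. *)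
Lemma mksE (a b : R) : mks a b = rc a + imag_unit * rc b.
Proof.
rewrite /imag_unit /rc /mks; case: k => /=; first by rewrite mul0r addr0.
rewrite /GRing.mul /GRing.add/=.
by rewrite !mul0r !mulr0 !mul1r subr0 addr0 !add0r.
Qed.

Lemma parts (z : F) : z = mks (res z) (ims z).
Proof. by rewrite /mks /res /ims; case: k z => // -[]. Qed.

Lemma conjsK : involutive (@conjs R k).
Proof. by rewrite /conjs; case: k => //= z; rewrite conjCK. Qed.

Lemma res_conjs (z : F) : res (conjs z) = res z.
Proof. by rewrite /res /conjs; case: k z => //= -[]. Qed.

Lemma ims_conjs (z : F) : ims (conjs z) = - ims z.
Proof. by rewrite /ims /conjs; case: k z => //= z; [rewrite oppr0|case: z]. Qed.

Lemma conjs_rc r : conjs (rc r) = rc r.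
Proof.
by rewrite [LHS]parts res_conjs ims_conjs rcK ims_rc oppr0.
Qed.

Lemma conjs_ge0 (z : F) : 0 <= z -> conjs z = z.
Proof. by move=> /rcE ->; rewrite conjs_rc. Qed.

Lemma norm_conjs (z : F) : `|conjs z| = `|z|.
Proof.
apply/eqP; rewrite -(@eqrXn2 _ 2)//.
by rewrite -!mul_conjs conjsK mulrC.
Qed.

(** Recombines the two halves of the polarization identity in both cases at once: over the complex
    numbers the second summand is [z - conjs z], over the reals it is [0] and [conjs z = z]. *)
Lemma polarization_scalar (z : F) :
  (z + conjs z) + imag_unit * (conjs imag_unit * z + imag_unit * conjs z) =
  z *+ 2.
Proof.
rewrite /imag_unit /conjs /mks; case: k z => /= [z|z].
  by rewrite mul0r addr0 mulr2n.
have -> : (0 +i* 1)%C = 'i :> R[i] by [].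
rewrite conjCi mulrDr !mulrA mulrN -expr2 sqrCi opprK mul1r mulN1r.
by rewrite addrACA subrr addr0 mulr2n.
Qed.

(** Discriminant inequality for a Hermitian form in two variables: the common source of the Schwarz
    inequalities for [form_on] and for [<A x, y>]. *)
Lemma pos_quadratic_cs (a c z : F) :
  (forall x y : F, 0 <= x * conjs x * a + x * conjs y * z +
                        conjs x * y * conjs z + y * conjs y * c) ->
  `|z| ^+ 2 <= a * c.
Proof.
move=> h.
have a0 : 0 <= a.
  by have := h 1 0; rewrite rmorph1 rmorph0 !(mul0r,mulr0,addr0,mul1r).
have c0 : 0 <= c.
  by have := h 0 1; rewrite rmorph1 rmorph0 !(mul0r,mulr0,add0r,mul1r).
have [c00|cn0] := eqVneq c 0; last first.
  have cp : 0 < c by rewrite lt_def cn0.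
  (* At [(c, - z)] the form equals [c * (a * c - |z|^2)]. *)
  have := h c (- z); rewrite rmorphN (conjs_ge0 c0)/=.
  rewrite (_ : _ + _ = c * (a * c - z * conjs z)); last by ring.
  by rewrite pmulr_rge0// mul_conjs subr_ge0.
rewrite c00 mulr0; have [->|z0] := eqVneq z 0; first by rewrite normr0 expr0n.
have s0 : 0 < `|z| ^+ 2 by rewrite exprn_gt0// normr_gt0.
have t0 : 0 <= (a + 1) / `|z| ^+ 2 by rewrite divr_ge0 ?addr_ge0// ltW.
(* If [c = 0], the form is affine in the size of the second variable; this size makes it
   [a - 2 (a + 1) < 0] unless [z = 0]. *)
have := h 1 (- ((a + 1) / `|z| ^+ 2 * z)).
set t := _ / _ in t0 *; rewrite rmorphN rmorphM rmorph1 c00/= (conjs_ge0 t0).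
rewrite (_ : _ + _ = a - 2 * (t * (z * conjs z))); last by ring.
rewrite mul_conjs divfK ?gt_eqF//.
rewrite (_ : _ - _ = - (a + 2)); last by ring.
rewrite oppr_ge0 => a2; have : 0 < a + 2 by rewrite ltr_wpDl.
by move/lt_geF; rewrite a2.
Qed.

Section Limits.
Context {T : Type} {G : set_system T} {FG : ProperFilter G}.
Implicit Types u : T -> F.

Lemma res_cvg u (l : F) : u @ G --> l -> (res \o u) @ G --> res l.
Proof.
move=> /cvgrPdist_lt ul; apply/cvgrPdist_lt => e e0.
have := ul (rc e); rewrite rc_gt0 => /(_ e0); apply: filterS => t.
rewrite norm_rcE ltr_rc; apply: le_lt_trans.
by rewrite /= -raddfB res_norm.
Qed.

Lemma ims_cvg u (l : F) : u @ G --> l -> (ims \o u) @ G --> ims l.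
Proof.
move=> /cvgrPdist_lt ul; apply/cvgrPdist_lt => e e0.
have := ul (rc e); rewrite rc_gt0 => /(_ e0); apply: filterS => t.
rewrite norm_rcE ltr_rc; apply: le_lt_trans.
by rewrite /= -raddfB ims_norm.
Qed.

Lemma rc_cvg (u : T -> R) l : u @ G --> l -> (rc \o u) @ G --> (rc l : F).
Proof.
move=> /cvgrPdist_lt ul; apply/cvgrPdist_lt => e e0.
have := ul (res e) (res_gt0 e0); apply: filterS => t.
by rewrite /= -rmorphB norm_rc (rcE (ltW e0)) rcK ltr_rc.
Qed.

Lemma mks_cvg (u v : T -> R) l m : u @ G --> l -> v @ G --> m ->
  (fun t => mks (u t) (v t) : F) @ G --> (mks l m : F).
Proof.
move=> ul vm; under eq_fun do rewrite mksE.
by rewrite mksE; apply: cvgD; [exact: rc_cvg|apply: cvgMr; exact: rc_cvg].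
Qed.

Lemma conjs_cvg u (l : F) : u @ G --> l -> (fun t => conjs (u t)) @ G --> (conjs l : F).
Proof.
move=> /cvgrPdist_lt ul; apply/cvgrPdist_lt => e e0.
by have := ul e e0; apply: filterS => t; rewrite -rmorphB/= norm_conjs.
Qed.

Lemma scalar_cvg_unique u (l m : F) : u @ G --> l -> u @ G --> m -> l = m.
Proof. exact: cvg_unique. Qed.

Lemma cvg_scalar_ge0 u (l : F) : u @ G --> l -> (forall t, 0 <= u t) -> 0 <= l.
Proof.
move=> ul u0.
have ru : rc \o (res \o u) = u by apply/funext => t /=; rewrite -rcE.
have /rc_cvg := res_cvg ul; rewrite ru => /(scalar_cvg_unique ul) ->.
rewrite rc_ge0; have rul := res_cvg ul.
rewrite -(cvg_lim (@Rhausdorff R) rul); apply: limr_ge.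
  by apply/cvg_ex; exists (res l).
by near=> t; exact: res_ge0.
Unshelve. all: by end_near. Qed.

Lemma cvg_scalar_le u v (l m : F) : u @ G --> l -> v @ G --> m ->
  (forall t, u t <= v t) -> l <= m.
Proof.
move=> ul vm uv; rewrite -subr_ge0.
by apply: (cvg_scalar_ge0 (cvgB vm ul)) => t; rewrite subr_ge0.
Qed.

End Limits.

Lemma nonneg_series_cvg (a : nat -> F) (M : F) :
  (forall i, 0 <= a i) -> (forall n, \sum_(i < n) a i <= M) ->
  cvgn (fun n => \sum_(i < n) a i).
Proof.
move=> a0 aM.
have : cvgn (fun n => \sum_(i < n) res (a i)).
  apply: nondecreasing_is_cvgn.
    apply/nondecreasing_seqP => n; rewrite big_ord_recr/= lerDl.
    exact: res_ge0.
  exists (res M) => _ [n _ <-]; rewrite -raddf_sum; exact: res_le.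
case/cvg_ex => l /rc_cvg al; apply/cvg_ex; exists (rc l).
suff -> : (fun n => \sum_(i < n) a i) = rc \o (fun n => \sum_(i < n) res (a i)) by [].
apply/funext => n /=; rewrite rmorph_sum; apply: eq_bigr => i _; exact: rcE.
Qed.

End ScalarTheory.
Arguments imag_unit {R k}.

(** * Hilbert spaces *)

Section HilbertTheory.
Context {R : realType} {k : scalar_kind} {E : hilbertType R k}.
Local Notation F := (scalars R k).
Implicit Types x y z : E.

Lemma innerDr x y z : inner E z (x + y) = inner E z x + inner E z y.
Proof. by rewrite innerC innerDl rmorphD/= -!innerC. Qed.

Lemma inner0r y : inner E y 0 = 0.
Proof. by rewrite innerC inner0l rmorph0. Qed.

Lemma innerNl x y : inner E (- x) y = - inner E x y.
Proof. by rewrite -sub0r innerBl inner0l sub0r. Qed.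

Lemma innerNr x y : inner E y (- x) = - inner E y x.
Proof. by rewrite -sub0r innerBr inner0r sub0r. Qed.

Lemma inner_suml I (r : seq I) (P : pred I) (f : I -> E) y :
  inner E (\sum_(i <- r | P i) f i) y = \sum_(i <- r | P i) inner E (f i) y.
Proof.
apply: (big_morph (fun z => inner E z y)); last exact: inner0l.
by move=> ? ?; exact: innerDl.
Qed.

Lemma inner_sumr I (r : seq I) (P : pred I) (f : I -> E) y :
  inner E y (\sum_(i <- r | P i) f i) = \sum_(i <- r | P i) inner E y (f i).
Proof.
apply: (big_morph (fun z => inner E y z)); last exact: inner0r.
by move=> ? ?; exact: innerDr.
Qed.

Lemma inner_ge0 x : 0 <= inner E x x.
Proof. by rewrite -inner_norm exprn_ge0. Qed.

Lemma inner_eq0 x : inner E x x = 0 -> x = 0.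
Proof. by rewrite -inner_norm => /eqP; rewrite sqrf_eq0 normr_eq0 => /eqP. Qed.

Lemma inner_cvgr (T : Type) (G : set_system T) (FG : ProperFilter G)
    (u : T -> E) (l y : E) :
  u @ G --> l -> (fun n => inner E y (u n)) @ G --> inner E y l.
Proof.
move=> /cvgrPdist_lt ul; apply/cvgrPdist_lt => e e0.
have y1 : 0 < `|y| + 1 by rewrite ltr_wpDl.
have := ul (e / (`|y| + 1)) (divr_gt0 e0 y1); apply: filterS => t.
rewrite ltr_pdivlMr// => lt; rewrite -innerBr.
rewrite (le_lt_trans (cauchy_schwarz _ _))// (le_lt_trans _ lt)// mulrC.
by rewrite ler_wpM2l// lerDl.
Qed.

Definition nr x : R := res `|x|.

Lemma nrE x : `|x| = rc (nr x).
Proof. exact: rcE. Qed.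

Lemma nr_ge0 x : 0 <= nr x.
Proof. exact: res_ge0. Qed.

Lemma nr_sqr x : nr x ^+ 2 = res (inner E x x).
Proof. by rewrite -inner_norm nrE -rmorphXn/= rcK. Qed.

Lemma nr_sqrD x y :
  nr (x + y) ^+ 2 = nr x ^+ 2 + nr y ^+ 2 + 2 * res (inner E x y).
Proof.
rewrite !nr_sqr innerDl !innerDr !resD (innerC y x) res_conjs; ring.
Qed.

Lemma nr_scale (a : R) x : nr (rc a *: x) = `|a| * nr x.
Proof. by rewrite /nr normrZ norm_rc nrE -rmorphM/= !rcK. Qed.

Lemma dense_seq (S : set E) x : dense S ->
  exists2 u : nat -> E, (forall n, S (u n)) & u @ \oo --> x.
Proof.
move=> dS.
have ball_S (e : F) : 0 < e -> exists2 u, S u & `|x - u| < e.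
  move=> e0; have /dS : (ball x e)° !=set0.
    by exists x; apply: nbhs_singleton; apply: nbhs_interior; exact: nbhsx_ballx.
  move=> /(_ (@open_interior _ _))[u [/interior_subset xu Su]].
  by exists u => //; move: xu; rewrite -ball_normE.
have h n : exists u, S u /\ `|x - u| < rc (n.+1%:R^-1).
  have [|u Su xu] := ball_S (rc (n.+1%:R^-1)); last by exists u.
  by rewrite rc_gt0 invr_gt0.
have [u /all_and2 [Su xu]] := choice h.
exists u => //; apply/cvgrPdist_lt => e e0; near=> n.
apply: lt_trans (xu n) _; rewrite (rcE (ltW e0)) ltr_rc.
near: n; have := near_infty_natSinv_lt (PosNum (res_gt0 e0)).
exact.
Unshelve. all: by end_near. Qed.

Lemma dense_orthogonal (S : set E) x : dense S ->
  (forall u, S u -> inner E u x = 0) -> x = 0.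
Proof.
move=> /(dense_seq x)[u Su ux] S0; apply: inner_eq0.
have := inner_cvg (y := x) ux; under eq_fun do rewrite S0//.
by move=> /(scalar_cvg_unique (cvg_cst _)).
Qed.

(** Test the bound on a sequence of [S] converging to [x] itself: the limit is [|x|^2 <= M |x|]. *)
Lemma dense_norm_le (S : set E) x (M : F) : dense S -> 0 <= M ->
  (forall u, S u -> `|inner E u x| <= M * `|u|) -> `|x| <= M.
Proof.
move=> /(dense_seq x)[u Su ux] M0 SM.
have [->|x0] := eqVneq x 0; first by rewrite normr0.
have : `|inner E x x| <= M * `|x|.
  apply: (cvg_scalar_le (G := \oo) (u := fun n => `|inner E (u n) x|)
    (v := fun n => M * `|u n|)); last by move=> n; exact: SM.
  - by apply: cvg_norm; exact: inner_cvg.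
  - by apply: cvgMr; exact: cvg_norm.
rewrite ger0_norm ?inner_ge0// -inner_norm expr2.
by rewrite ler_pM2r// normr_gt0.
Qed.

Lemma nonneg_quadratic_linear (a b : R) : 0 <= b ->
  (forall t, 0 <= 2 * t * a + t ^+ 2 * b) -> a = 0.
Proof.
move=> b0 h; have b1 : 0 < b + 1 by rewrite ltr_wpDl.
(* Nearly the minimiser [- a / b]; the [+ 1] also covers [b = 0]. *)
have := h (- a / (b + 1)).
rewrite (_ : _ + _ = - (a / (b + 1)) ^+ 2 * (b + 2)); last first.
  by field; rewrite gt_eqF.
rewrite mulNr oppr_ge0 => h2.
have : (a / (b + 1)) ^+ 2 = 0.
  apply/eqP; rewrite eq_le sqr_ge0 andbT.
  by rewrite pmulr_lle0 in h2 => //; rewrite ltr_wpDl.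
move/eqP; rewrite sqrf_eq0 mulf_eq0 invr_eq0 (gt_eqF b1) orbF.
by move/eqP.
Qed.

(** The variational argument for Riesz representation controls real parts only; this recovers the
    scalar identity. *)
Lemma scalar_eq0 (z : F) : res z = 0 -> res (imag_unit * z) = 0 -> z = 0.
Proof.
rewrite /imag_unit /res /mks; case: k z => //= -[a b] /= -> /eqP.
by rewrite mul0r mul1r sub0r oppr_eq0 => /eqP ->.
Qed.

(* [G] is the graph of a linear functional defined on a subspace; no
   extension to the closure is needed before representing it. *)
Lemma riesz_graph (G : set (E * F)) (M : R) : G (0, 0) ->
  (forall a p q, G p -> G q -> G (p.1 + a *: q.1, p.2 + a * q.2)) ->
  (forall p, G p -> `|p.2| <= rc M * `|p.1|) ->
  exists2 w, (forall p, G p -> p.2 = inner E p.1 w) &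
             (forall e : F, 0 < e -> exists2 p, G p & `|w - p.1| < e).
Proof.
move=> G0 GD GM.
(* The Riesz vector is the minimiser of [|x|^2 - 2 Re phi(x)]. The functional is bounded below by
   [- M^2], because [(|x| - M)^2 >= 0]. *)
pose J (p : E * F) := nr p.1 ^+ 2 - 2 * res p.2.
have JM p : G p -> - M ^+ 2 <= J p.
  move=> Gp; have : res p.2 <= M * nr p.1.
    apply: le_trans (ler_norm _) _; apply: le_trans (res_norm _) _.
    by rewrite -(@ler_rc R k) -norm_rcE rmorphM/= -nrE GM.
  have := sqr_ge0 (nr p.1 - M); rewrite /J; nra.
have hinf : has_inf (J @` G).
  split; first by exists (J (0, 0)); exists (0, 0).
  by exists (- M ^+ 2) => _ [p Gp <-]; exact: JM.
set d := inf (J @` G).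
have dJ p : G p -> d <= J p.
  by move=> Gp; apply: ge_inf; [exact: hinf.2|exists p].
have h n : exists p, G p /\ J p < d + n.+1%:R^-1.
  have n0 : 0 < n.+1%:R^-1 :> R by rewrite invr_gt0.
  have [_ [p Gp <-] Jp] := inf_adherent n0 hinf.
  by exists p.
have [p /all_and2[Gp Jp]] := choice h.
(* Parallelogram law: [J] is at least [d] at the midpoint of two almost minimisers, so they are
   close and the minimising sequence is Cauchy. *)
have JB m n : nr ((p m).1 - (p n).1) ^+ 2 <= 2 * (m.+1%:R^-1 + n.+1%:R^-1).
  have G2 : G ((p m).1 + 1 *: (p n).1, (p m).2 + 1 * (p n).2) by exact: GD.
  have := dJ _ (GD (rc 2^-1) _ _ G0 G2).
  rewrite /J/= !add0r scale1r mul1r nr_scale.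
  have -> : res (rc 2^-1 * ((p m).2 + (p n).2)) =
      2^-1 * (res (p m).2 + res (p n).2).
    by rewrite resM rcK ims_rc mul0r subr0 resD.
  have := Jp m; have := Jp n; rewrite /J.
  rewrite ger0_norm ?invr_ge0// exprMn !nr_sqrD innerNr.
  have -> : nr (- (p n).1) = nr (p n).1 by rewrite /nr normrN.
  have -> : 2^-1 ^+ 2 = 1 / 4 :> R by field.
  move: (m.+1%:R^-1) (n.+1%:R^-1) => ? ?; rewrite raddfN/=; lra.
have : cvgn (fun n => (p n).1).
  apply/cauchy_cvgP; apply: cauchy_exP => e e0.
  have e2 : 0 < res e ^+ 2 / 4 by rewrite divr_gt0// exprn_gt0// res_gt0.
  have [N _ HN] := near_infty_natSinv_lt (PosNum e2).
  exists (p N).1; exists N => // n /= Nn; rewrite -ball_normE /=.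
  rewrite nrE (rcE (ltW e0)) ltr_rc -(@ltr_pXn2r _ 2)// ?nnegrE ?nr_ge0 ?res_ge0 ?ltW//.
  apply: le_lt_trans (JB _ _) _.
  have : n.+1%:R^-1 < res e ^+ 2 / 4 := HN n Nn.
  have : N.+1%:R^-1 < res e ^+ 2 / 4 := HN N (leqnn N).
  move: (N.+1%:R^-1) (n.+1%:R^-1) => ? ?; lra.
case/cvg_ex => w pw; exists w; last first.
  move=> e e0; move/cvgrPdist_lt: pw => /(_ e e0)[N _ /(_ N (leqnn N)) pN].
  by exists (p N).
(* First variation: compare [J] at [p n] and at [p n + t q], let [n] tend to infinity, and use that
   the resulting quadratic in [t] is nonnegative. *)
have re q : G q -> res (inner E q.1 w) = res q.2.
  move=> Gq; apply/eqP; rewrite -subr_eq0; apply/eqP.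
  apply: (@nonneg_quadratic_linear _ (nr q.1 ^+ 2)); first by rewrite sqr_ge0.
  move=> t.
  have hn n : 0 <= 2 * t * (res (inner E q.1 (p n).1) - res q.2) +
      t ^+ 2 * nr q.1 ^+ 2 + n.+1%:R^-1.
    have := dJ _ (GD (rc t) _ _ (Gp n) Gq); have := Jp n; rewrite /J/=.
    rewrite nr_sqrD nr_scale innerZr conjs_rc resD !resM !rcK !ims_rc.
    rewrite !mul0r !subr0 exprMn real_normK ?num_real//.
    rewrite (innerC _ q.1) res_conjs; move: (n.+1%:R^-1) => ?.
    nra.
  have : (fun n => 2 * t * (res (inner E q.1 (p n).1) - res q.2) +
      t ^+ 2 * nr q.1 ^+ 2 + n.+1%:R^-1) @ \oo -->
     2 * t * (res (inner E q.1 w) - res q.2) + t ^+ 2 * nr q.1 ^+ 2 + 0.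
    apply: cvgD; last exact: cvg_harmonic.
    apply: cvgD; last exact: cvg_cst.
    apply: cvgMr; apply: cvgB; last exact: cvg_cst.
    by apply: res_cvg; exact: inner_cvgr.
  rewrite addr0 => /[dup] /cvgP cl /cvg_lim <-//.
  by apply: limr_ge => //; apply: nearW.
move=> q Gq; apply/eqP; rewrite eq_sym -subr_eq0; apply/eqP.
apply: scalar_eq0; first by rewrite raddfB/= re// subrr.
(* Applying the real identity to [imag_unit *: q] supplies the imaginary part. *)
have := re _ (GD imag_unit _ _ G0 Gq); rewrite /= !add0r innerZl => rr.
by rewrite mulrBr raddfB/= rr subrr.
Qed.

End HilbertTheory.

(** * Bounded operators from bounded positive forms on a total family *)

Section FormOperator.
Context {R : realType} {k : scalar_kind} {E : hilbertType R k}.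
Local Notation F := (scalars R k).
Context {I : Type} (tau : I -> E).

(** Formal combinations are lists, so that sums are concatenations and a form on them is a double
    sum, with no choice of representation for a vector. *)
Definition combination (s : seq (F * I)) : E := \sum_(p <- s) p.1 *: tau p.2.

Lemma span_combination u : linear_span (range tau) u ->
  exists s, u = combination s.
Proof.
case=> n [c [s [rs ->]]].
have [i is_] := choice (fun j => (fun h => let: ex_intro2 a _ b := h in
  ex_intro (fun a => tau a = s j) a b) (rs j)).
exists [seq (c j, i j) | j <- index_enum 'I_n].
by rewrite /combination big_map; apply: eq_bigr => j _ /=; rewrite is_.
Qed.

Hypothesis tau_dense : dense (linear_span (range tau)).

Lemma span_orthogonal z : (forall i, inner E (tau i) z = 0) -> z = 0.
Proof.
move=> h; apply: (dense_orthogonal tau_dense) => _ /span_combination[s ->].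
rewrite inner_suml big1// => p _; by rewrite innerZl h mulr0.
Qed.

(** The functional [tau i |-> phi i] needs no separate proof of well-definedness: the bound vanishes
    on formal combinations with zero sum, and [riesz_graph] accepts the relation [G]. *)
Lemma riesz_family (phi : I -> F) (M : R) :
  (forall s, `|\sum_(p <- s) p.1 * phi p.2| <= rc M * `|combination s|) ->
  exists w, forall i, phi i = inner E (tau i) w.
Proof.
move=> h.
pose G := [set p : E * F |
  exists s, p = (combination s, \sum_(p <- s) p.1 * phi p.2)].
have [||_ [s ->]|w Gw _] := @riesz_graph _ _ E G M.
- by exists [::]; rewrite /combination !big_nil.
- move=> a _ _ [s ->] [t ->] /=.
  exists (s ++ [seq (a * p.1, p.2) | p <- t]).
  rewrite /combination !big_cat !big_map/= scaler_sumr mulr_sumr.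
  by congr (_ + _, _ + _); apply: eq_bigr => p _; rewrite ?scalerA ?mulrA.
- exact: h.
exists w => i.
have /Gw/= : G (tau i, phi i).
  by exists [:: (1, i)]; rewrite /combination !big_seq1 scale1r mul1r.
exact.
Qed.

Definition form_on (b : I -> I -> F) (s t : seq (F * I)) : F :=
  \sum_(p <- s) \sum_(q <- t) p.1 * conjs q.1 * b p.2 q.2.

Variables (b : I -> I -> F) (M : R).
Hypothesis b_hermitian : forall i j, b j i = conjs (b i j).
Hypothesis b_ge0 : forall s, 0 <= form_on b s s.
Hypothesis b_le : forall s, form_on b s s <= rc M * `|combination s| ^+ 2.

Lemma form_on_catl s t u : form_on b (s ++ t) u = form_on b s u + form_on b t u.
Proof. by rewrite /form_on big_cat. Qed.

Lemma form_on_catr s t u : form_on b u (s ++ t) = form_on b u s + form_on b u t.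
Proof. by rewrite /form_on -big_split/=; apply: eq_bigr => p _; rewrite big_cat. Qed.

Definition scale_comb (a : F) (s : seq (F * I)) := [seq (a * p.1, p.2) | p <- s].

Lemma form_on_scale x y s t :
  form_on b (scale_comb x s) (scale_comb y t) = x * conjs y * form_on b s t.
Proof.
rewrite /form_on big_map mulr_sumr; apply: eq_bigr => p _.
rewrite big_map mulr_sumr; apply: eq_bigr => q _ /=.
rewrite rmorphM/=; ring.
Qed.

Lemma form_on_conj s t : form_on b t s = conjs (form_on b s t).
Proof.
rewrite /form_on exchange_big/= rmorph_sum/=; apply: eq_bigr => p _.
rewrite rmorph_sum/=; apply: eq_bigr => q _.
rewrite !rmorphM/= conjsK -b_hermitian; ring.
Qed.

Lemma form_on_cs s t :
  `|form_on b s t| ^+ 2 <= form_on b s s * form_on b t t.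
Proof.
apply: pos_quadratic_cs => x y.
have := b_ge0 (scale_comb x s ++ scale_comb y t).
rewrite form_on_catl !form_on_catr !form_on_scale -(form_on_conj s t).
by rewrite addrA (mulrC y (conjs x)).
Qed.

Hypothesis M_ge0 : 0 <= M.

Lemma form_on_bound s t :
  `|form_on b s t| <= rc M * `|combination s| * `|combination t|.
Proof.
have M0 : (0 : F) <= rc M by rewrite rc_ge0.
rewrite -(@ler_pXn2r _ 2)// ?nnegrE ?mulr_ge0//.
apply: le_trans (form_on_cs _ _) _.
apply: le_trans (ler_pM (b_ge0 s) (b_ge0 t) (b_le s) (b_le t)) _.
by rewrite le_eqVlt; apply/orP; left; apply/eqP; ring.
Qed.

(** Riesz representation is used twice. First [w j] represents [b (-, j)], and the Schwarz
    inequality for [b] bounds [tau j |-> w j] on formal combinations; then [T] is the adjoint of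
    this densely defined map, which is defined on all of [E] without an extension by continuity. *)
Lemma operator_of_form : exists2 T : E -> E, bounded_operator T &
  forall i j, inner E (T (tau i)) (tau j) = b i j.
Proof.
have M0 : (0 : F) <= rc M by rewrite rc_ge0.
have h1 j : exists w, forall i, b i j = inner E (tau i) w.
  apply: (@riesz_family (b ^~ j) (M * nr (tau j))) => s.
  have := form_on_bound s [:: (1, j)]; rewrite /form_on.
  under eq_bigr => p _ do rewrite big_seq1 rmorph1 mulr1.
  rewrite {2}/combination big_seq1 scale1r => /le_trans; apply.
  by rewrite rmorphM/= -nrE mulrAC.
have [w bw] := choice h1.
pose W (s : seq (F * I)) := \sum_(p <- s) p.1 *: w p.2.
have WM s : `|W s| <= rc M * `|combination s|.
  apply: (dense_norm_le tau_dense); first by rewrite mulr_ge0.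
  move=> _ /span_combination[t ->].
  have -> : inner E (combination t) (W s) = form_on b t s.
    rewrite inner_suml; apply: eq_bigr => p _; rewrite innerZl inner_sumr.
    rewrite mulr_sumr; apply: eq_bigr => q _.
    by rewrite innerZr bw mulrA.
  by rewrite mulrAC; exact: form_on_bound.
(* [z] is the value at [y] of the adjoint of [combination s |-> W s]. *)
have h2 y : exists z, forall i, inner E (w i) y = inner E (tau i) z.
  apply: (@riesz_family (fun i => inner E (w i) y) (M * nr y)) => s.
  have -> : \sum_(p <- s) p.1 * inner E (w p.2) y = inner E (W s) y.
    by rewrite inner_suml; apply: eq_bigr => p _; rewrite innerZl.
  apply: le_trans (cauchy_schwarz _ _) _.
  by rewrite rmorphM/= -nrE mulrAC ler_wpM2r.
have [T wT] := choice h2; exists T; last first.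
  by move=> i j; rewrite innerC -wT -innerC -bw.
split.
  move=> a x y; apply/eqP; rewrite -subr_eq0; apply/eqP.
  apply: span_orthogonal => i.
  rewrite innerBr innerDr innerZr -!wT innerDr innerZr; exact: subrr.
exists (rc M) => x; apply: (dense_norm_le tau_dense); first by rewrite mulr_ge0.
move=> _ /span_combination[t ->].
have -> : inner E (combination t) (T x) = inner E (W t) x.
  by rewrite !inner_suml; apply: eq_bigr => p _; rewrite !innerZl -wT.
apply: le_trans (cauchy_schwarz _ _) _.
by rewrite mulrAC ler_wpM2r.
Qed.

End FormOperator.

(** * Schur product theorem *)

Section Schur.
Context {R : realType} {k : scalar_kind} {H : hilbertType R k} {Y : Type}.
Local Notation F := (scalars R k).
Variable N : Y -> Y -> F.
Hypothesis N_ge0 : forall s, 0 <= form_on N s s.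

(** The Schur product of a Gram matrix with [N], evaluated at the all-ones vector; coefficients are
    absorbed in the vectors [p.1]. *)
Definition gram_form (s : seq (H * Y)) : F :=
  \sum_(p <- s) \sum_(q <- s) inner H p.1 q.1 * N p.2 q.2.

(** Entrywise, [a^2 <p, q> = <p', q'> + a <p, u> conj <q, u>], where [p' = a p - <p, u> u] is [a]
    times the component of [p] orthogonal to [u]; the factor [a] avoids a division. *)
Lemma gram_form_split (s : seq (H * Y)) (u : H) : let a := inner H u u in
  a ^+ 2 * gram_form s =
  gram_form [seq (a *: p.1 - inner H p.1 u *: u, p.2) | p <- s] +
  a * form_on N [seq (inner H p.1 u, p.2) | p <- s]
                [seq (inner H p.1 u, p.2) | p <- s].
Proof.
move=> a; have ca : conjs a = a by apply: conjs_ge0; exact: inner_ge0.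
rewrite /gram_form /form_on !big_map !mulr_sumr -big_split/=.
apply: eq_bigr => p _; rewrite !big_map !mulr_sumr -big_split/=.
apply: eq_bigr => q _.
rewrite !innerBl !innerBr !innerZl !innerZr ca -/a (innerC u q.1); ring.
Qed.

Lemma gram_form_cons0 y s : gram_form ((0, y) :: s) = gram_form s.
Proof.
rewrite /gram_form big_cons/= big1 ?add0r; last first.
  by move=> q _; rewrite inner0l mul0r.
by apply: eq_bigr => p _; rewrite big_cons/= inner0r mul0r add0r.
Qed.

(* Schur product theorem: eliminate one vector at a time, replacing the others
   by their (unnormalised) projections on its orthogonal complement. *)
Lemma gram_form_ge0 s : 0 <= gram_form s.
Proof.
have [n] := ubnP (size s); elim: n s => // n IHn [|[u y] s].
  by rewrite /gram_form big_nil.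
rewrite ltnS => sn; have [u0|u0] := eqVneq u 0.
  by rewrite u0 gram_form_cons0 IHn.
have a0 : 0 < inner H u u by rewrite -inner_norm exprn_gt0// normr_gt0.
rewrite -(@pmulr_rge0 _ (inner H u u ^+ 2)) ?exprn_gt0// gram_form_split.
rewrite addr_ge0//; last by rewrite mulr_ge0// ltW.
by rewrite /= subrr gram_form_cons0 IHn// size_map.
Qed.

(** [gram_form_split] gives [a] times the rank-one form [<= a^2 gram_form s <= a C gram_form s].
    With [u] the kernel section at a point [t], [<p, u>] is the value at [t], and [C] may be any
    bound of [K(t, t)]. *)
Lemma gram_form_rank_one (s : seq (H * Y)) (u : H) (C : F) : inner H u u <= C ->
  0 <= \sum_(p <- s) \sum_(q <- s)
         (C * inner H p.1 q.1 - inner H p.1 u * conjs (inner H q.1 u)) *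
         N p.2 q.2.
Proof.
move=> uC.
set a := inner H u u in uC; have a0 : 0 <= a by exact: inner_ge0.
have -> : \sum_(p <- s) \sum_(q <- s)
         (C * inner H p.1 q.1 - inner H p.1 u * conjs (inner H q.1 u)) *
         N p.2 q.2 =
    C * gram_form s - form_on N [seq (inner H p.1 u, p.2) | p <- s]
                       [seq (inner H p.1 u, p.2) | p <- s].
  rewrite /gram_form /form_on big_map mulr_sumr -sumrB; apply: eq_bigr => p _.
  rewrite big_map mulr_sumr -sumrB; apply: eq_bigr => q _ /=; ring.
have [au|au] := eqVneq a 0.
  rewrite subr_ge0 [X in X <= _](_ : _ = 0).
    by rewrite mulr_ge0 ?gram_form_ge0// (le_trans a0).
  rewrite /form_on big_map big1// => p _; rewrite big_map big1// => q _ /=.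
  by rewrite (inner_eq0 au) inner0r !mul0r.
have ap : 0 < a by rewrite lt_def au.
rewrite -(pmulr_rge0 _ ap) mulrBr subr_ge0.
apply: (@le_trans _ _ (a ^+ 2 * gram_form s)).
  by rewrite gram_form_split lerDr gram_form_ge0.
rewrite mulrA expr2; apply: ler_wpM2r; first exact: gram_form_ge0.
by apply: ler_wpM2l.
Qed.

End Schur.

(** * Riemann sums *)

Section RiemannSums.
Context {d : measure_display} {T : measurableType d}.

(** Cells are the fibres of a labelling, so that disjointness and covering are automatic and the
    join of two partitions is the pair of labels. Cells may be empty. *)
Record partition := Partition {
  ncells : nat ;
  cell_of : T -> 'I_ncells ;
  cell_of_measurable : forall c, measurable (cell_of @^-1` [set c]) }.

(** The condition on nodes is quantified over points, not over labels, so it constrains only the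
    nodes of nonempty cells. *)
Record tagged_partition := TaggedPartition {
  tagged_base :> partition ;
  node : 'I_(ncells tagged_base) -> T ;
  cell_of_node : forall t,
    cell_of tagged_base (node (cell_of tagged_base t)) = cell_of tagged_base t }.

Definition refines (P : partition) : set tagged_partition :=
  [set Q | forall t t', cell_of Q t = cell_of Q t' -> cell_of P t = cell_of P t'].

Definition fine_partitions : set_system tagged_partition :=
  filter_from setT refines.

Definition join_cell_of (P Q : partition) (t : T) :=
  enum_rank (cell_of P t, cell_of Q t).

Fact join_cell_of_measurable (P Q : partition) c :
  measurable (join_cell_of P Q @^-1` [set c]).
Proof.
rewrite (_ : _ @^-1` _ = (cell_of P @^-1` [set (enum_val c).1]) `&`
                         (cell_of Q @^-1` [set (enum_val c).2])).
  by apply: measurableI; exact: cell_of_measurable.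
apply/seteqP; split => t /=; first by move=> <-; rewrite enum_rankK.
by move=> [pt qt]; rewrite /join_cell_of pt qt -surjective_pairing enum_valK.
Qed.

Definition join_partition (P Q : partition) : partition :=
  Partition (@join_cell_of_measurable P Q).

Fact tag_node (P : partition) : exists node : 'I_(ncells P) -> T,
  forall t, cell_of P (node (cell_of P t)) = cell_of P t.
Proof.
(* The default [point] is the node of an empty cell. *)
exists (fun c => xget point [set t | cell_of P t = c]) => t.
by case: xgetP => [//|/(_ t)]; case.
Qed.

Global Instance fine_partitions_filter : ProperFilter fine_partitions.
Proof.
apply: filter_from_proper; first apply: filter_from_filter.
- have m1 (c : 'I_1) : measurable ((fun _ : T => ord0 : 'I_1) @^-1` [set c]).
    rewrite (_ : _ @^-1` _ = setT); first exact: measurableT.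
    by apply/seteqP; split => // t _ /=; rewrite (ord1 c).
  by exists (Partition m1).
- move=> P Q _ _; exists (join_partition P Q) => // S PQS.
  by split => t t' /PQS /enum_rank_inj [].
- move=> P _; have [node nodeE] := tag_node P.
  by exists (TaggedPartition nodeE).
Qed.

(** [W] is a general function of node and cell, so that the same sum covers integrands, total masses
    and matrix entries. *)
Definition riemann_sum {V : nmodType} (W : T -> set T -> V)
    (P : tagged_partition) : V :=
  \sum_(c : 'I_(ncells P)) W (node c) (cell_of P @^-1` [set c]).

Lemma near_refines (P : partition) : fine_partitions (refines P).
Proof. by exists P. Qed.

Context {R : realType}.

Lemma fine_partition (h : T -> R) (M e : R) : measurable_fun setT h ->
  (forall t, `|h t| <= M) -> 0 < e ->
  exists P : partition, forall t t',
    cell_of P t = cell_of P t' -> `|h t - h t'| <= e.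
Proof.
move=> mh hM e0.
have M0 : 0 <= M by exact: le_trans (hM point).
(* The cells are level sets of [h] of width [e]; as [0 <= h t + M <= M + M], labels are at most [n]
   and [inord] does not alter them. *)
pose n := Num.truncn ((M + M) / e).
have x0 t : 0 <= (h t + M) / e.
  rewrite divr_ge0// ?(ltW e0)//; have := hM t; rewrite ler_norml; lra.
pose f t : 'I_n.+1 := inord (Num.truncn ((h t + M) / e)).
have fE t : nat_of_ord (f t) = Num.truncn ((h t + M) / e).
  rewrite inordK// ltnS le_truncn// ler_pM2r ?invr_gt0//.
  by rewrite lerD2r; have := hM t; rewrite ler_norml => /andP[].
have fP t c : (f t == c) = (c%:R * e - M <= h t < c.+1%:R * e - M).
  rewrite -val_eqE/= fE truncn_eq// ler_pdivlMr// ltr_pdivrMr//.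
  by rewrite lerBlDr ltrBrDr.
have mf c : measurable (f @^-1` [set c]).
  rewrite (_ : _ @^-1` _ = setT `&` h @^-1` `[c%:R * e - M, c.+1%:R * e - M[).
    exact: mh.
  rewrite setTI; apply/seteqP; split => t /=.
    by rewrite in_itv/= -fP => ->.
  by rewrite in_itv/= -fP => /eqP.
exists (Partition mf) => t t' /= ff.
have := fP t (f t); have := fP t' (f t'); rewrite !eqxx ff.
move=> /esym/andP[a b] /esym/andP[a' b'].
rewrite ler_norml; move: a b a' b'; rewrite -natr1 mulrDl mul1r.
move: (_ * e) => z; lra.
Qed.

Lemma bounded_measurable_integrable (m : {finite_measure set T -> \bar R})
    (h : T -> R) (M : R) :
  measurable_fun setT h -> (forall t, `|h t| <= M) ->
  m.-integrable setT (EFin \o h).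
Proof.
move=> mh hM; apply: measurable_bounded_integrable => //.
  by rewrite -ge0_fin_numE// fin_num_measure.
exists M; split; first exact: num_real.
by move=> y /ltW My t _ /=; exact: le_trans (hM t) My.
Qed.

Lemma riemann_sum_bound (m : {finite_measure set T -> \bar R}) (h : T -> R)
    (M e : R) (P : tagged_partition) : measurable_fun setT h ->
  (forall t, `|h t| <= M) -> (forall t, `|h t - h (node (cell_of P t))| <= e) ->
  `|\int[m]_t h t - riemann_sum (fun t B => h t * fine (m B)) P|
    <= e * fine (m setT).
Proof.
move=> mh hM he; have ih := bounded_measurable_integrable m mh hM.
have mc c : measurable (cell_of P @^-1` [set c]) by exact: cell_of_measurable.
(* The Riemann sum is the integral of the step function [\sum_c g c], which is within [e] of [h]. *)
pose g (c : 'I_(ncells P)) t := h (node c) * \1_(cell_of P @^-1` [set c]) t.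
have ig c : m.-integrable setT (EFin \o g c).
  apply: (@bounded_measurable_integrable m (g c) `|h (node c)|).
    by apply: measurable_funM => //; exact: measurable_indic.
  move=> t; rewrite /g indicE; case: (t \in _); first by rewrite mulr1.
  by rewrite mulr0 normr0.
have gE t : h (node (cell_of P t)) = \sum_c g c t.
  rewrite (bigD1 (cell_of P t))//= big1 => [|c ct]; rewrite /g indicE.
    by rewrite mem_set//= mulr1 addr0.
  by rewrite memNset ?mulr0//= => ct'; rewrite ct' eqxx in ct.
have isum : m.-integrable setT (EFin \o (fun t => \sum_c g c t)).
  rewrite (_ : _ \o _ = (fun t => \sum_c (g c t)%:E)%E).
    by apply: integrable_sum => // c _; exact: ig.
  by apply/funext => t /=; rewrite sumEFin.
have sumE : riemann_sum (fun t B => h t * fine (m B)) P =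
    \int[m]_t (\sum_c g c t).
  rewrite /Rintegral.
  under eq_integral => t _ do rewrite -sumEFin.
  rewrite integral_sum//.
  rewrite -sum_fine; last first.
    by move=> c _; exact: (integrable_fin_num measurableT (ig c)).
  apply: eq_bigr => c _.
  rewrite -/(Rintegral m setT (g c)) /g RintegralZl//; last first.
    apply: (@bounded_measurable_integrable m _ 1); first exact: measurable_indic.
    by move=> t; rewrite indicE; case: (t \in _); rewrite ?normr1 ?normr0.
  by congr (_ * _); rewrite /Rintegral integral_indic// setIT.
have iD : m.-integrable setT (EFin \o (fun t => h t - \sum_c g c t)).
  by have := integrableB measurableT ih isum; apply: eq_integrable.
rewrite sumE -RintegralB//.
apply: le_trans (le_normr_Rintegral measurableT iD) _.
rewrite -Rintegral_cst//; apply: le_Rintegral => //.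
- by have := integrable_norm iD; apply: eq_integrable.
- exact: finite_measure_integrable_cst.
- by move=> t _; rewrite -gE.
Qed.

Lemma riemann_cvg (m : {finite_measure set T -> \bar R}) (h : T -> R) (M : R) :
  measurable_fun setT h -> (forall t, `|h t| <= M) ->
  riemann_sum (fun t B => h t * fine (m B)) @ fine_partitions -->
  \int[m]_t h t.
Proof.
move=> mh hM; apply/cvgrPdist_le => e e0.
have m0 : 0 <= fine (m setT) by rewrite fine_ge0.
(* The [+ 1] covers the zero measure. *)
have m1 : 0 < fine (m setT) + 1 by rewrite ltr_wpDl.
have [P hP] := fine_partition mh hM (divr_gt0 e0 m1).
apply: filterS (near_refines P) => Q PQ.
apply: le_trans (riemann_sum_bound m mh hM (P := Q) (e := e / (fine (m setT) + 1)) _) _.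
  by move=> t; apply/hP/PQ; rewrite cell_of_node.
by rewrite mulrAC ler_pdivrMr// ler_wpM2l ?(ltW e0)// lerDl.
Qed.

(** The Jordan parts recombine in every cell, so the approximants involve only the values [nu B]. *)
Lemma riemann_cvg_charge (nu : {charge set T -> \bar R}) (h : T -> R) (M : R) :
  measurable_fun setT h -> (forall t, `|h t| <= M) ->
  riemann_sum (fun t B => h t * fine (nu B)) @ fine_partitions -->
  charge_integral nu h.
Proof.
move=> mh hM; rewrite /charge_integral.
set J := svalP (hahn_pair nu).
rewrite [X in X @ _](_ : _ =
    riemann_sum (fun t B => h t * fine (jordan_pos J B)) \-
    riemann_sum (fun t B => h t * fine (jordan_neg J B))).
  by apply: cvgB; apply: riemann_cvg hM.
apply/funext => P; rewrite /= /riemann_sum -sumrB; apply: eq_bigr => c _.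
rewrite -mulrBr; congr (_ * _).
rewrite (jordan_decomp J); last exact: cell_of_measurable.
rewrite /cadd/= fineD ?fin_num_measure//=; try exact: cell_of_measurable.
by rewrite cscaleN1 fineN.
Qed.

End RiemannSums.
Arguments fine_partitions {d T}.

(** * Integrals of kernel functions *)

Section PartitionSums.
Context {d : measure_display} {T : measurableType d} {R : realType}.

(** Finite additivity read off from the error bound for the constant function [1], where the
    oscillation [e] is [0]. *)
Lemma measure_partition_sum (m : {finite_measure set T -> \bar R})
    (P : tagged_partition) :
  riemann_sum (fun _ B => fine (m B)) P = fine (m setT).
Proof.
have := @riemann_sum_bound _ T R m (cst 1) 1 0 P.
rewrite mul0r Rintegral_cst// mul1r normr_le0 subr_eq0 => h.
have /eqP-> : fine (m setT) ==
    riemann_sum (fun (t : T) (B : set T) => cst 1 t * fine (m B)) P.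
  apply: h => [|t|t]; first exact: measurable_cst.
    by rewrite normr1.
  by rewrite subrr normr0.
by apply: eq_bigr => c _; rewrite mul1r.
Qed.

Lemma charge_partition_sum (nu : {charge set T -> \bar R})
    (P : tagged_partition) :
  riemann_sum (fun _ B => fine (nu B)) P = fine (nu setT).
Proof.
pose J := svalP (hahn_pair nu).
have nuE B : measurable B ->
    fine (nu B) = fine (jordan_pos J B) - fine (jordan_neg J B).
  move=> mB; rewrite (jordan_decomp J)// /cadd/= fineD ?fin_num_measure//=.
  by rewrite cscaleN1 fineN.
rewrite nuE// -!(measure_partition_sum _ P) /riemann_sum -sumrB.
by apply: eq_bigr => c _; rewrite nuE//; exact: cell_of_measurable.
Qed.

Import HBNNSimple.

(** Integrals are suprema over simple functions, whose fibres are measurable. This is needed because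
    an induced measure is a bare set function, meaningful on Borel sets only. *)
Lemma eq_integral_on_measurable (P : set T -> \bar R)
    (m : {measure set T -> \bar R}) :
  (forall B, measurable B -> P B = m B) ->
  forall D f, integral P D f = integral m D f.
Proof.
move=> Pm D f; rewrite /integral.
congr (_ - _)%E; congr ereal_sup; apply: eq_imagel => h _;
  rewrite /sintegral; apply: eq_fsbigr => r _; rewrite Pm//; exact: measurable_sfunP.
Qed.

End PartitionSums.

Section IntegralLimits.
Context {R : realType} {k : scalar_kind} {X : ptopologicalType}.
Local Notation F := (scalars R k).
Local Notation BX := (borel X).

Lemma sum_cvg (T I : Type) (G : set_system T) (FG : ProperFilter G)
    (r : seq I) (u : I -> T -> F) (l : I -> F) :
  (forall i, u i @ G --> l i) ->
  (fun t => \sum_(i <- r) u i t) @ G --> \sum_(i <- r) l i.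
Proof.
move=> ul; elim: r => [|i r IHr].
  by rewrite big_nil; under eq_fun do rewrite big_nil; exact: cvg_cst.
rewrite big_cons; under eq_fun do rewrite big_cons.
by apply: cvgD.
Qed.

Definition bounded_measurable (h : BX -> F) :=
  [/\ exists M : R, forall t, `|h t| <= rc M,
      measurable_fun setT (res \o h) & measurable_fun setT (ims \o h)].

Lemma bounded_parts (h : BX -> F) : bounded_measurable h -> exists M,
  (forall t, `|(res \o h) t| <= M) /\ (forall t, `|(ims \o h) t| <= M).
Proof.
case=> -[M hM] _ _; exists M; split=> t; have := res_le (hM t); rewrite rcK.
  exact: le_trans (res_norm _).
exact: le_trans (ims_norm _).
Qed.

Lemma bounded_measurable_cst a : bounded_measurable (cst a).
Proof.
split; [|exact: (measurable_cst (res a))|exact: (measurable_cst (ims a))].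
by exists (res `|a|) => t; rewrite -norm_rcE.
Qed.

Lemma bounded_measurableD f g : bounded_measurable f -> bounded_measurable g ->
  bounded_measurable (fun t => f t + g t).
Proof.
move=> [[M fM] rf if_] [[M' gM'] rg ig]; split.
- exists (M + M') => t; rewrite rmorphD.
  by apply: le_trans (ler_normD _ _) _; exact: lerD.
- rewrite (_ : _ \o _ = (res \o f) \+ (res \o g)); first exact: measurable_funD.
  by apply/funext => t; rewrite /= resD.
- rewrite (_ : _ \o _ = (ims \o f) \+ (ims \o g)); first exact: measurable_funD.
  by apply/funext => t; rewrite /= imsD.
Qed.

Lemma bounded_measurableM f g : bounded_measurable f -> bounded_measurable g ->
  bounded_measurable (fun t => f t * g t).
Proof.
move=> [[M fM] rf if_] [[M' gM'] rg ig]; split.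
- exists (M * M') => t; rewrite rmorphM normrM.
  by apply: ler_pM => //; exact: le_trans (fM t).
- rewrite (_ : _ \o _ = ((res \o f) \* (res \o g)) \- ((ims \o f) \* (ims \o g))).
    by apply: measurable_funB; exact: measurable_funM.
  by apply/funext => t; rewrite /= resM.
- rewrite (_ : _ \o _ = ((res \o f) \* (ims \o g)) \+ ((ims \o f) \* (res \o g))).
    by apply: measurable_funD; exact: measurable_funM.
  by apply/funext => t; rewrite /= imsM.
Qed.

Lemma bounded_measurable_conjs f : bounded_measurable f ->
  bounded_measurable (fun t => conjs (f t)).
Proof.
move=> [[M fM] rf if_]; split.
- by exists M => t; rewrite norm_conjs.
- by rewrite (_ : _ \o _ = res \o f)//; apply/funext => t; rewrite /= res_conjs.
- rewrite (_ : _ \o _ = \- (ims \o f)); first exact: measurableT_comp.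
  by apply/funext => t; rewrite /= ims_conjs.
Qed.

Lemma povm_partition_sum (Q : hilbertType R k) (nu : povm X Q) (x y : Q)
    (P : tagged_partition) :
  riemann_sum (fun _ B => inner Q (nu B x) y) P = inner Q x y.
Proof.
rewrite [RHS](_ : _ = inner Q (nu setT x) y); last by rewrite povm_setT.
rewrite [LHS]parts [RHS]parts /riemann_sum; congr mks.
  by rewrite raddf_sum; exact: (charge_partition_sum (povm_re nu x y)).
by rewrite raddf_sum; exact: (charge_partition_sum (povm_im nu x y)).
Qed.

Lemma povm_integral_cvg (Q : hilbertType R k) (nu : povm X Q) (x y : Q)
    (h : BX -> F) : bounded_measurable h ->
  riemann_sum (fun t B => h t * inner Q (nu B x) y) @ fine_partitions -->
  povm_integral nu x y h.
Proof.
move=> bh; have [M [rM iM]] := bounded_parts bh; case: bh => _ rh ih.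
rewrite /povm_integral.
rewrite [X in X @ _](_ : _ = fun P => mks
   (riemann_sum (fun t B => (res \o h) t * fine (povm_re nu x y B)) P -
    riemann_sum (fun t B => (ims \o h) t * fine (povm_im nu x y B)) P)
   (riemann_sum (fun t B => (ims \o h) t * fine (povm_re nu x y B)) P +
    riemann_sum (fun t B => (res \o h) t * fine (povm_im nu x y B)) P)).
  by apply: mks_cvg; [apply: cvgB|apply: cvgD]; apply: riemann_cvg_charge;
    eassumption.
apply/funext => P; rewrite [LHS]parts /riemann_sum; congr mks.
  by rewrite raddf_sum -sumrB; apply: eq_bigr => c _; rewrite /= resM.
by rewrite raddf_sum -big_split/=; apply: eq_bigr => c _; rewrite imsM addrC.
Qed.

Lemma measure_integral_cvg (P : set BX -> \bar R)
    (m : {finite_measure set BX -> \bar R}) (h : BX -> F) :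
  (forall B, measurable B -> P B = m B) -> bounded_measurable h ->
  riemann_sum (fun t B => h t * rc (fine (m B))) @ fine_partitions -->
  measure_integral P h.
Proof.
move=> Pm bh; have [M [rM iM]] := bounded_parts bh; case: bh => _ rh ih.
rewrite /measure_integral !(eq_integral_on_measurable Pm).
rewrite [X in X @ _](_ : _ = fun Q => mks
   (riemann_sum (fun t B => (res \o h) t * fine (m B)) Q)
   (riemann_sum (fun t B => (ims \o h) t * fine (m B)) Q)).
  by apply: mks_cvg; apply: riemann_cvg; eassumption.
apply/funext => Q; rewrite [LHS]parts /riemann_sum; congr mks.
  rewrite raddf_sum; apply: eq_bigr => c _.
  by rewrite /= resM rcK ims_rc mulr0 subr0.
rewrite raddf_sum; apply: eq_bigr => c _.
by rewrite /= imsM rcK ims_rc mulr0 add0r.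
Qed.

Lemma continuous_measurable (f : X -> R) : continuous f ->
  measurable_fun (setT : set BX) (f : BX -> R).
Proof.
move=> /continuousP cf; apply: (measurability _ (RGenOpens.measurableE R)).
move=> _ [_ [a [b ->] <-]]; rewrite setTI.
by apply: sub_sigma_algebra; apply: cf; exact: interval_open.
Qed.

End IntegralLimits.

(** * Boundedness and measurability of the functions in the RKHS *)

Section KernelSections.
Context {R : realType} {k : scalar_kind} {X : ptopologicalType}.
Local Notation F := (scalars R k).
Context {K : X -> X -> F} (H : rkhs K).

Lemma rkhs_evalD f g t : rkhs_eval (f + g : H) t = rkhs_eval f t + rkhs_eval g t.
Proof. by rewrite !rkhs_reproducing innerDl. Qed.

Lemma inner_section t : inner H (rkhs_section H t) (rkhs_section H t) = K t t.
Proof. by rewrite -rkhs_reproducing rkhs_sectionE. Qed.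

(** Represent [<-, f>] on the span of the sections: the Riesz vector [w] lies in the closure of that
    span and has the same inner products with all sections as [f]. By the reproducing property both
    are the same function, so [f = w]. *)
Lemma sections_total (f : H) (e : F) : 0 < e ->
  exists s, `|f - combination (@rkhs_section _ _ _ _ H) s| < e.
Proof.
move=> e0; pose tau := @rkhs_section _ _ _ _ H.
pose G := [set p : H * F |
  exists s, p = (combination tau s, inner H (combination tau s) f)].
have [||_ [s ->]|w Gw clw] := @riesz_graph _ _ H G (nr f).
- by exists [::]; rewrite /combination big_nil inner0l.
- move=> a _ _ [s ->] [t ->] /=.
  exists (s ++ scale_comb a t).
  have -> : combination tau (s ++ scale_comb a t) =
      combination tau s + a *: combination tau t.
    rewrite /combination big_cat big_map/= scaler_sumr; congr (_ + _).
    by apply: eq_bigr => p _; rewrite scalerA.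
  by rewrite innerDl innerZl.
- by rewrite /= -nrE mulrC; exact: cauchy_schwarz.
have -> : f = w.
  apply: rkhs_eval_inj; apply/funext => t.
  have /Gw/= : G (tau t, inner H (tau t) f).
    by exists [:: (1, t)]; rewrite /combination !big_seq1 scale1r.
  by rewrite !rkhs_reproducing (innerC f) (innerC w) => ->.
by have [_ [s ->]] := clw e e0; exists s.
Qed.

Hypothesis C0K : C0_kernel K.

Lemma kernel_bound : exists2 M : R, 0 <= M & forall t, K t t <= rc M.
Proof.
case: C0K => _ [M KM] _.
have M0 : 0 <= M by apply: le_trans (KM point); rewrite -inner_section inner_ge0.
by exists (res M); [exact: res_ge0|move=> t; rewrite -rcE].
Qed.

Lemma rkhs_eval_bound : exists2 M : R, 0 <= M &
  forall (f : H) t, `|rkhs_eval f t| <= rc M * `|f|.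
Proof.
(* [M <= (1 + M)^2], so [1 + M] bounds the norms of the sections without a square root. *)
have [M M0 KM] := kernel_bound; exists (1 + M); first by rewrite addr_ge0.
move=> f t; rewrite rkhs_reproducing.
apply: le_trans (cauchy_schwarz _ _) _; rewrite mulrC ler_wpM2r//.
rewrite nrE ler_rc -(@ler_pXn2r _ 2)// ?nnegrE ?nr_ge0 ?addr_ge0//.
rewrite nr_sqr inner_section; have := res_le (KM t); rewrite rcK; nra.
Qed.

Lemma kernel_section_bounded_measurable x : bounded_measurable (X := X) (K ^~ x).
Proof.
case: C0K => _ _ /(_ x)[cK _].
have [M M0 fM] := rkhs_eval_bound; split.
- exists (M * nr (rkhs_section H x)) => t.
  by rewrite rmorphM/= -nrE; have := fM (rkhs_section H x) t; rewrite rkhs_sectionE.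
- by apply: continuous_measurable => t; apply: res_cvg; exact: cK.
- by apply: continuous_measurable => t; apply: ims_cvg; exact: cK.
Qed.

(** Norm convergence implies pointwise convergence, so [f] is a pointwise limit of combinations of
    the continuous sections. *)
Lemma rkhs_bounded_measurable (f : H) : bounded_measurable (X := X) (rkhs_eval f).
Proof.
have [M M0 fM] := rkhs_eval_bound.
have h n : exists s, `|f - combination (@rkhs_section _ _ _ _ H) s| < rc (n.+1%:R^-1).
  by apply: sections_total; rewrite rc_gt0 invr_gt0.
have [s fs] := choice h.
pose g n := combination (@rkhs_section _ _ _ _ H) (s n).
have bg n : bounded_measurable (X := X) (rkhs_eval (g n)).
  rewrite /g; elim: (s n) => [|[c x] r IHr].
    rewrite (_ : rkhs_eval _ = cst 0); first exact: bounded_measurable_cst.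
    by apply/funext => t; rewrite rkhs_reproducing /combination big_nil inner0l.
  rewrite (_ : rkhs_eval _ = fun t => cst c t * K t x +
      rkhs_eval (combination (@rkhs_section _ _ _ _ H) r) t).
    apply: bounded_measurableD => //; apply: bounded_measurableM.
      exact: bounded_measurable_cst.
    exact: kernel_section_bounded_measurable.
  apply/funext => t; rewrite /combination big_cons/= rkhs_evalD; congr (_ + _).
  by rewrite rkhs_reproducing innerZl -rkhs_reproducing rkhs_sectionE.
have gf : g @ \oo --> f.
  apply/cvgrPdist_lt => e e0; near=> n.
  apply: lt_trans (fs n) _; rewrite (rcE (ltW e0)) ltr_rc.
  by near: n; exact: (near_infty_natSinv_lt (PosNum (res_gt0 e0))).
have gft t : (fun n => rkhs_eval (g n) t) @ \oo --> rkhs_eval f t.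
  rewrite rkhs_reproducing; under eq_fun do rewrite rkhs_reproducing.
  exact: inner_cvg.
split.
- by exists (M * nr f) => t; rewrite rmorphM/= -nrE.
- apply: (@measurable_fun_cvg _ (borel X) R setT
    (fun n => res \o (rkhs_eval (g n) : borel X -> F))).
    by move=> n; case: (bg n).
  by move=> t _; exact: (res_cvg (gft t)).
- apply: (@measurable_fun_cvg _ (borel X) R setT
    (fun n => ims \o (rkhs_eval (g n) : borel X -> F))).
    by move=> n; case: (bg n).
  by move=> t _; exact: (ims_cvg (gft t)).
Unshelve. all: by end_near. Qed.

Lemma fprod_bounded_measurable (f g : H) : bounded_measurable (X := X) (Defs.fprod f g).
Proof.
apply: bounded_measurableM; first exact: rkhs_bounded_measurable.
by apply: bounded_measurable_conjs; exact: rkhs_bounded_measurable.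
Qed.

Section OperatorOfIntegral.
Context {E : hilbertType R k} {Y : Type} (tau : H * Y -> E).
Context (N : set (borel X) -> Y -> Y -> F) (n : Y -> Y -> F).
Context (b : H * Y -> H * Y -> F).
Hypothesis tau_dense : dense (linear_span (range tau)).
Hypothesis tau_inner : forall p q,
  inner E (tau p) (tau q) = inner H p.1 q.1 * n p.2 q.2.
Hypothesis N_hermitian : forall B y z, measurable B ->
  N B z y = conjs (N B y z).
Hypothesis N_ge0 : forall B s, measurable B -> 0 <= form_on (N B) s s.
Hypothesis N_total : forall P y z, riemann_sum (fun _ B => N B y z) P = n y z.
Hypothesis b_cvg : forall p q : H * Y,
  riemann_sum (fun (t : borel X) B => Defs.fprod p.1 q.1 t * N B p.2 q.2)
    @ fine_partitions --> b p q.

(** Stated over an abstract index type [Y] to serve both embeddings: [Y = Q] for a POVM on the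
    tensor product, [Y = unit] for a probability on [H]. *)
Lemma operator_of_integral : exists2 T : E -> E, bounded_operator T &
  forall p q, inner E (T (tau p)) (tau q) = b p q.
Proof.
have [M M0 KM] := kernel_bound.
pose rs P (p q : H * Y) :=
  riemann_sum (fun (t : borel X) B => Defs.fprod p.1 q.1 t * N B p.2 q.2) P.
have form_cvg s : (fun P => form_on (rs P) s s) @ fine_partitions --> form_on b s s.
  by apply: sum_cvg => p; apply: sum_cvg => q; apply: cvgMr; exact: b_cvg.
(* Within a cell, the values at the node become coefficients of a single positive form [N B]. *)
have rsE P s : form_on (rs P) s s = \sum_c
    form_on (N (cell_of P @^-1` [set c]))
      [seq (p.1 * rkhs_eval p.2.1 (node c), p.2.2) | p <- s]
      [seq (p.1 * rkhs_eval p.2.1 (node c), p.2.2) | p <- s].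
  rewrite /form_on; under [RHS]eq_bigr do rewrite big_map.
  rewrite [RHS]exchange_big/=; apply: eq_bigr => p _.
  under [RHS]eq_bigr do rewrite big_map.
  rewrite [RHS]exchange_big/=; apply: eq_bigr => q _.
  rewrite /rs /riemann_sum mulr_sumr; apply: eq_bigr => c _.
  by rewrite /Defs.fprod rmorphM/=; ring.
apply: (operator_of_form tau_dense (M := M)) => //.
- move=> p q.
  have bqp := conjs_cvg (@b_cvg p q).
  apply: (scalar_cvg_unique (u := fun P => rs P q p) (@b_cvg q p)).
  have -> : (fun P => rs P q p) = (fun P => conjs (rs P p q)); last exact: bqp.
  apply/funext => P; rewrite /rs /riemann_sum rmorph_sum; apply: eq_bigr => c _.
  rewrite /Defs.fprod !rmorphM/= conjsK -N_hermitian; last exact: cell_of_measurable.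
  by rewrite (mulrC (conjs _)).
- move=> s; apply: (cvg_scalar_ge0 (form_cvg s)) => P.
  by rewrite rsE sumr_ge0// => c _; apply: N_ge0; exact: cell_of_measurable.
- move=> s.
  apply: (cvg_scalar_le (form_cvg s) (cvg_cst _)) => P.
  (* [N_total] distributes the squared norm over the cells, so that the upper bound can be proved in
     each cell by [gram_form_rank_one]. *)
  have -> : `|combination tau s| ^+ 2 = \sum_c \sum_(p <- s) \sum_(q <- s)
      p.1 * conjs q.1 * inner H p.2.1 q.2.1 *
      N (cell_of P @^-1` [set c]) p.2.2 q.2.2.
    rewrite inner_norm inner_suml [RHS]exchange_big/=; apply: eq_bigr => p _.
    rewrite inner_sumr [RHS]exchange_big/=; apply: eq_bigr => q _.
    rewrite innerZl innerZr tau_inner -(N_total P) /riemann_sum !mulr_sumr.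
    by apply: eq_bigr => c _; ring.
  rewrite rsE mulr_sumr -subr_ge0 -sumrB; apply: sumr_ge0 => c _.
  have := @gram_form_rank_one _ _ H _ (N (cell_of P @^-1` [set c])) _
    [seq (p.1 *: p.2.1, p.2.2) | p <- s] (rkhs_section H (node c)) (rc M).
  rewrite inner_section => /(_ _ (KM _)).
  have NB t : 0 <= form_on (N (cell_of P @^-1` [set c])) t t.
    by apply: N_ge0; exact: cell_of_measurable.
  move=> /(_ NB); congr (0 <= _).
  rewrite /form_on !big_map mulr_sumr -sumrB; apply: eq_bigr => p _.
  rewrite !big_map mulr_sumr -sumrB; apply: eq_bigr => q _ /=.
  rewrite !innerZl !innerZr -!rkhs_reproducing rmorphM/=; ring.
Qed.

End OperatorOfIntegral.
End KernelSections.

(** * Orthonormal systems and traces *)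

Section NonnegOperators.
Context {R : realType} {k : scalar_kind} {Q : hilbertType R k}.
Local Notation F := (scalars R k).
Implicit Types (x y z : Q) (e : nat -> Q).

Lemma id_nonneg_operator : nonneg_operator (@id Q).
Proof.
split=> //; last exact: inner_ge0.
by split; [move=> a x y|exists 1 => x; rewrite mul1r].
Qed.

Lemma bounded_operator_pos (T : Q -> Q) : bounded_operator T ->
  exists2 M : R, 0 <= M & forall x, `|T x| <= rc M * `|x|.
Proof.
case=> _ [M TM]; exists (res `|M|); first exact: res_ge0.
move=> x; apply: le_trans (real_ler_norm (ger0_real (normr_ge0 (T x)))) _.
rewrite normr_id (le_trans (TM x))// -norm_rcE.
have [->|x0] := eqVneq x 0; first by rewrite normr0 !mulr0.
(* A bound in [F] could a priori be non-real; a nonzero [x] excludes this, since [M * |x|] is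
   nonnegative. *)
have MR : M \is Num.real.
  have h : 0 <= M * `|x| by exact: le_trans (TM x).
  by rewrite pmulr_lge0 ?normr_gt0// in h; exact: ger0_real.
by rewrite ler_wpM2r// real_ler_norm.
Qed.

Section Form.
Variables (A : Q -> Q) (A_nonneg : nonneg_operator A).

Lemma nonneg_operatorD x y : A (x + y) = A x + A y.
Proof.
case: A_nonneg => -[lA _] _ _.
by have := lA 1 x y; rewrite !scale1r.
Qed.

Lemma nonneg_operator0 : A 0 = 0.
Proof.
have := nonneg_operatorD 0 0; rewrite addr0 => /eqP.
by rewrite -subr_eq0 opprD addNKr oppr_eq0 => /eqP.
Qed.

Lemma nonneg_operatorZ a x : A (a *: x) = a *: A x.
Proof.
case: A_nonneg => -[lA _] _ _.
by have := lA a x 0; rewrite !addr0 nonneg_operator0 addr0.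
Qed.

Lemma nonneg_operatorB x y : A (x - y) = A x - A y.
Proof. by rewrite -scaleN1r nonneg_operatorD nonneg_operatorZ scaleN1r. Qed.

Lemma nonneg_operator_sum I (r : seq I) (P : pred I) (f : I -> Q) :
  A (\sum_(i <- r | P i) f i) = \sum_(i <- r | P i) A (f i).
Proof. exact: (big_morph A nonneg_operatorD nonneg_operator0). Qed.

Lemma nonneg_operator_sym x y : inner Q (A x) y = inner Q x (A y).
Proof. by case: A_nonneg. Qed.

Lemma nonneg_operatorC x y : inner Q (A y) x = conjs (inner Q (A x) y).
Proof. by rewrite nonneg_operator_sym innerC. Qed.

Lemma nonneg_operator_ge0 x : 0 <= inner Q (A x) x.
Proof. by case: A_nonneg. Qed.

Lemma nonneg_operator_cs x y :
  `|inner Q (A x) y| ^+ 2 <= inner Q (A x) x * inner Q (A y) y.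
Proof.
apply: pos_quadratic_cs => a b.
have := nonneg_operator_ge0 (a *: x + b *: y).
rewrite nonneg_operatorD !nonneg_operatorZ !innerDl !innerDr.
rewrite !innerZl !innerZr (nonneg_operatorC x y) -!mulrA => h.
apply: le_trans h _; rewrite le_eqVlt; apply/orP; left; apply/eqP; ring.
Qed.

(** Schwarz followed by the arithmetic-geometric mean: sums of mixed terms reduce to sums of
    diagonal ones. *)
Lemma nonneg_operator_mean x y :
  `|inner Q (A x) y| <= 2^-1 * (inner Q (A x) x + inner Q (A y) y).
Proof.
have x0 := nonneg_operator_ge0 x; have y0 := nonneg_operator_ge0 y.
rewrite -(@ler_pXn2r _ 2)// ?nnegrE ?mulr_ge0 ?addr_ge0 ?invr_ge0//.
apply: le_trans (nonneg_operator_cs x y) _.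
rewrite (rcE x0) (rcE y0) -rmorphM -rmorphD/= (_ : 2^-1 = rc 2^-1); last first.
  by rewrite fmorphV rmorph_nat.
rewrite -rmorphM -rmorphXn/= ler_rc.
move: (res _) (res _) => a b; have := sqr_ge0 (a - b); nra.
Qed.

(** For an orthosystem [e], what remains of [x] after its projection on the first [n] vectors, with
    respect to [<A x, y>]. *)
Definition residual e n x := x - \sum_(i < n) inner Q (A x) (e i) *: e i.

Definition orthosystem e := (forall i, e i = 0 \/ inner Q (A (e i)) (e i) = 1) /\
  forall i j, i != j -> inner Q (A (e i)) (e j) = 0.

Lemma residualB e n x y : residual e n (x - y) = residual e n x - residual e n y.
Proof.
rewrite /residual.
under eq_bigr => i _ do rewrite nonneg_operatorB innerBl scalerBl.
by rewrite sumrB !opprD !opprK addrACA.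
Qed.

Lemma inner_residual e n x y : inner Q (A (residual e n x)) y =
  inner Q (A x) y -
  \sum_(i < n) inner Q (A x) (e i) * inner Q (A (e i)) y.
Proof.
rewrite nonneg_operatorB innerBl nonneg_operator_sum inner_suml.
by congr (_ - _); apply: eq_bigr => i _; rewrite nonneg_operatorZ innerZl.
Qed.

(* Gram-Schmidt for the semi-inner product [<A x, y>]. *)
Definition normalise x :=
  if inner Q (A x) x == 0 then 0
  else rc (Num.sqrt (res (inner Q (A x) x)))^-1 *: x.

Definition gram_schmidt (d : nat -> Q) e :=
  forall n, e n = normalise (residual e n (d n)).

Lemma gram_schmidt_exists d : exists e, gram_schmidt d e.
Proof.
pose step n (s : seq Q) :=
  normalise (d n - \sum_(i < n) inner Q (A (d n)) (nth 0 s i) *: nth 0 s i).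
(* Course-of-values recursion: [L n] lists the first [n] vectors, all of which enter step [n]. *)
pose fix L n := if n is m.+1 then rcons (L m) (step m (L m)) else [::].
pose e n := step n (L n).
have Le n : mkseq e n = L n.
  by elim: n => //= n IHn; rewrite mkseqS IHn.
exists e => n; rewrite {1}/e /step -Le; congr (normalise (_ - _)).
by apply: eq_bigr => i _; rewrite nth_mkseq.
Qed.

Lemma normalise_cases x : normalise x = 0 \/
  inner Q (A (normalise x)) (normalise x) = 1.
Proof.
rewrite /normalise; case: eqP => [|/eqP] x0; [by left|right].
set a := inner Q (A x) x in x0 *.
have a0 : 0 <= a by exact: nonneg_operator_ge0.
have ra : 0 < res a by apply: res_gt0; rewrite lt_def x0.
rewrite nonneg_operatorZ innerZl innerZr conjs_rc -/a {3}(rcE a0) -!rmorphM/=.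
rewrite mulrA -expr2 exprVn sqr_sqrtr ?(ltW ra)// mulVf ?rmorph1//.
by rewrite gt_eqF.
Qed.

(** Orthogonality is assumed only for indices below [n], which is what is available in the middle of
    the Gram-Schmidt induction. *)
Lemma residual_orthogonal e n x j :
  (forall i, e i = 0 \/ inner Q (A (e i)) (e i) = 1) ->
  (forall i, (i < n)%N -> i != j -> inner Q (A (e i)) (e j) = 0) ->
  (j < n)%N -> inner Q (A (residual e n x)) (e j) = 0.
Proof.
move=> e01 eo jn; rewrite inner_residual (bigD1 (Ordinal jn))//= big1 ?addr0.
  case: (e01 j) => ->; last by rewrite mulr1 subrr.
  by rewrite !inner0r mulr0 subrr.
move=> i ij; rewrite eo ?mulr0//.
Qed.

Lemma gram_schmidt_orthosystem d e : gram_schmidt d e -> orthosystem e.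
Proof.
move=> ed; have e01 i : e i = 0 \/ inner Q (A (e i)) (e i) = 1.
  by rewrite ed; exact: normalise_cases.
have eo n : forall i j, (i < n)%N -> (j < n)%N -> i != j ->
    inner Q (A (e i)) (e j) = 0.
  elim: n => // n IHn.
  have en j : (j < n)%N -> inner Q (A (e n)) (e j) = 0.
    move=> jn; rewrite ed /normalise; case: ifP => _.
      by rewrite nonneg_operator0 inner0l.
    rewrite nonneg_operatorZ innerZl residual_orthogonal ?mulr0// => i ni ij.
    exact: IHn.
  move=> i j; rewrite !ltnS (leq_eqVlt i) (leq_eqVlt j).
  move=> /predU1P[->|ni] /predU1P[->|nj].
  - by rewrite eqxx.
  - by move=> _; exact: en.
  - by move=> _; rewrite nonneg_operatorC en// rmorph0.
  - exact: IHn.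
split=> // i j ij; apply: (eo (maxn i j).+1) => //; rewrite ltnS.
  exact: leq_maxl.
exact: leq_maxr.
Qed.

Section Orthosystem.
Variables (e : nat -> Q) (oe : orthosystem e).

Lemma orthosystem_residual n x j : (j < n)%N ->
  inner Q (A (residual e n x)) (e j) = 0.
Proof.
by case: oe => e01 eo jn; apply: residual_orthogonal => // i _; exact: eo.
Qed.

Lemma inner_residual2 n x y :
  inner Q (A (residual e n x)) (residual e n y) =
  inner Q (A (residual e n x)) y.
Proof.
rewrite {2}/residual innerBr inner_sumr big1 ?subr0// => i _.
by rewrite innerZr orthosystem_residual ?mulr0.
Qed.

Lemma residual_sqr n x : inner Q (A (residual e n x)) (residual e n x) =
  inner Q (A x) x - \sum_(i < n) `|inner Q (A x) (e i)| ^+ 2.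
Proof.
rewrite inner_residual2 inner_residual; congr (_ - _); apply: eq_bigr => i _.
by rewrite (nonneg_operatorC x) mul_conjs.
Qed.

Lemma bessel n x :
  \sum_(i < n) `|inner Q (A x) (e i)| ^+ 2 <= inner Q (A x) x.
Proof. by rewrite -subr_ge0 -residual_sqr nonneg_operator_ge0. Qed.

Lemma residual_le m n x : (m <= n)%N ->
  inner Q (A (residual e n x)) (residual e n x) <=
  inner Q (A (residual e m x)) (residual e m x).
Proof.
move=> mn; rewrite !residual_sqr lerB//.
rewrite -!(big_mkord predT (fun i => `|inner Q (A x) (e i)| ^+ 2)).
by rewrite (@big_cat_nat _ _ _ m 0 n)//= lerDl sumr_ge0.
Qed.

(** Taking residuals does not increase the seminorm [<A x, x>], and residuals decrease with [n]; so
    it is enough to approximate [x] by vectors with null residual. *)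
Lemma residual_cvg0 :
  (forall x (d : F), 0 < d -> exists y m,
    inner Q (A (x - y)) (x - y) < d /\
    inner Q (A (residual e m y)) (residual e m y) = 0) ->
  forall x, (fun n => inner Q (A (residual e n x)) (residual e n x)) @ \oo -->
    (0 : F).
Proof.
move=> h x; apply/cvgrPdist_lt => d d0.
have [y [m [xyd ym]]] := h x d d0.
exists m => // n /= mn.
have yn : inner Q (A (residual e n y)) (residual e n y) = 0.
  apply/eqP; rewrite eq_le nonneg_operator_ge0 andbT.
  by rewrite -ym; exact: residual_le.
(* By Schwarz, an [A]-null vector is [A]-orthogonal to everything. *)
have yn0 z : inner Q (A z) (residual e n y) = 0.
  have := nonneg_operator_cs z (residual e n y); rewrite yn mulr0.
  move=> z0; apply/eqP; rewrite -normr_eq0 -sqrf_eq0.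
  by rewrite eq_le z0 exprn_ge0.
have -> : inner Q (A (residual e n x)) (residual e n x) =
    inner Q (A (residual e n (x - y))) (residual e n (x - y)).
  rewrite residualB nonneg_operatorB innerBr !innerBl !yn0.
  by rewrite (nonneg_operatorC _ (residual e n y)) yn0 rmorph0 !subr0.
rewrite sub0r normrN ger0_norm ?nonneg_operator_ge0//.
by apply: le_lt_trans xyd; rewrite residual_sqr lerBlDr lerDl sumr_ge0.
Qed.

End Orthosystem.

(** Up to an [A]-null vector, [d n] lies in the span of [e 0], ..., [e n]; hence the index
    [n.+1]. *)
Lemma gram_schmidt_residual d e n : gram_schmidt d e ->
  inner Q (A (residual e n.+1 (d n))) (residual e n.+1 (d n)) = 0.
Proof.
move=> ed; have oe := gram_schmidt_orthosystem ed.
have -> : residual e n.+1 (d n) = residual e n (d n) -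
    inner Q (A (residual e n (d n))) (e n) *: e n.
  rewrite {1}/residual big_ord_recr/= opprD addrA; congr (_ - _ *: _).
  rewrite inner_residual big1 ?subr0// => i _.
  by case: oe => _ ->; rewrite ?mulr0// neq_ltn ltn_ord.
set v := residual e n (d n).
rewrite ed -/v /normalise; case: eqP => [v0|/eqP v0].
  by rewrite scaler0 subr0.
set a := inner Q (A v) v in v0 *.
have a0 : 0 <= a by exact: nonneg_operator_ge0.
have ra : 0 < res a by apply: res_gt0; rewrite lt_def v0.
rewrite innerZr conjs_rc -/a {2}(rcE a0) scalerA -!rmorphM/=.
rewrite mulrAC -expr2 exprVn sqr_sqrtr ?(ltW ra)// mulVf ?gt_eqF//.
by rewrite rmorph1 scale1r subrr nonneg_operator0 inner0l.
Qed.

End Form.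

Lemma dense_sequence : separable_space Q ->
  exists d : nat -> Q, forall x (e : F), 0 < e -> exists n, `|x - d n| < e.
Proof.
case=> D /pcard_injP[f] finj dD.
(* [d] inverts the injection [f] of [D] into the naturals, with value [0] outside its range. *)
pose d n := xget 0 [set x | D x /\ f x = n].
exists d => x e e0; have [u Du /cvgrPdist_lt ux] := dense_seq x dD.
have [n _ /(_ n (leqnn n))/= xun] := ux e e0.
exists (f (u n)).
suff -> : d (f (u n)) = u n by [].
rewrite /d; case: xgetP => [y _ [Dy fy]|/(_ (u n))]; last by case.
by apply: finj fy; rewrite inE.
Qed.

Hypothesis sepQ : separable_space Q.

Lemma complete_orthosystem A : nonneg_operator A -> exists e, orthosystem A e /\
  forall x, (fun n => inner Q (A (residual A e n x)) (residual A e n x)) @ \oo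
    --> (0 : F).
Proof.
move=> A0; have [d dD] := dense_sequence sepQ.
have [e ed] := gram_schmidt_exists A d.
have oe := gram_schmidt_orthosystem A0 ed.
exists e; split=> //; apply: residual_cvg0 => // x r r0.
have [M M0 AM] := bounded_operator_pos (let: And3 b _ _ := A0 in b).
have M1 : (0 : F) < rc (M + 1) by rewrite rc_gt0 ltr_wpDl.
(* Boundedness of [A] turns norm density into density for [<A x, x>]; [s] is the norm accuracy
   sufficient for [r], and [M + 1] avoids dividing by zero. *)
have [s s0 sr] : exists2 s : F, 0 < s & rc (M + 1) * s ^+ 2 <= r.
  exists (rc (Num.sqrt (res r / (M + 1)))).
    by rewrite rc_gt0 sqrtr_gt0 divr_gt0 ?res_gt0// ltr_wpDl.
  rewrite -rmorphXn/= sqr_sqrtr; last first.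
    by apply: divr_ge0; [exact/res_ge0/ltW|exact: addr_ge0].
  by rewrite -rmorphM/= mulrC divfK ?gt_eqF ?ltr_wpDl// -rcE// ltW.
have [n xn] := dD x s s0; exists (d n), n.+1; split.
  apply: lt_le_trans sr; apply: (@le_lt_trans _ _ (rc M * `|x - d n| ^+ 2)).
    apply: le_trans (real_ler_norm (ger0_real (nonneg_operator_ge0 A0 _))) _.
    apply: le_trans (cauchy_schwarz _ _) _.
    by rewrite expr2 mulrA ler_wpM2r.
  apply: (@le_lt_trans _ _ (rc (M + 1) * `|x - d n| ^+ 2)).
    by rewrite ler_wpM2r ?exprn_ge0// ler_rc lerDl.
  by rewrite ltr_pM2l// ltr_pXn2r ?nnegrE ?(ltW s0).
exact: gram_schmidt_residual.
Qed.

Lemma projection_cvg e x :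
  (fun n => inner Q (residual id e n x) (residual id e n x)) @ \oo --> (0 : F) ->
  (fun n => \sum_(i < n) inner Q x (e i) *: e i) @ \oo --> x.
Proof.
move=> /cvgrPdist_lt h; apply/cvgrPdist_lt => d d0.
have := h (d ^+ 2) (exprn_gt0 _ d0); apply: filterS => n.
rewrite sub0r normrN -inner_norm normrX normr_id.
by rewrite ltr_pXn2r ?nnegrE ?(ltW d0).
Qed.

Lemma orthonormal_basis_exists : exists e : nat -> Q, orthonormal_basis e.
Proof.
have [e [[e01 eo] ecvg]] := complete_orthosystem id_nonneg_operator.
exists e; split => //.
  move=> i; case: (e01 i); first by left.
  rewrite -inner_norm => /eqP; rewrite sqrf_eq1 => /orP[/eqP|/eqP ei]; first by right.
  have := normr_ge0 (e i); rewrite ei oppr_ge0 => /le_lt_trans /(_ ltr01).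
  by rewrite ltxx.
move=> O [x Ox] oO; have := projection_cvg (ecvg x).
move=> /(_ O (open_nbhs_nbhs (conj oO Ox)))[n _ /(_ n (leqnn n))/= On].
exists (\sum_(i < n) inner Q x (e i) *: e i); split => //.
by exists n, (fun i => inner Q x (e i)), (fun i => e i); split => // i; exists i.
Qed.

Lemma orthonormal_basis_cvg e x : orthonormal_basis e ->
  (fun n => \sum_(i < n) inner Q x (e i) *: e i) @ \oo --> x.
Proof.
case=> e01 eo De; apply: projection_cvg.
have oe : orthosystem id e.
  split=> // i; case: (e01 i); first by left.
  by move=> e1; right; rewrite -inner_norm e1 expr1n.
apply: (residual_cvg0 id_nonneg_operator oe) => {}x d d0.
have [u Du /cvgrPdist_lt ux] := dense_seq x De.
have sd : 0 < rc (Num.sqrt (res d)) :> F by rewrite rc_gt0 sqrtr_gt0 res_gt0.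
have [n _ /(_ n (leqnn n))/= xun] := ux _ sd.
have [N [c [s [se uE]]]] := Du n.
have [l ls] := choice (fun j => (fun h => let: ex_intro2 a _ b := h in
  ex_intro (fun a => e a = s j) a b) (se j)).
(* Past the largest basis index occurring in [u n], the residual of [u n] vanishes. *)
exists (u n), (\max_(j < N) (l j).+1); split.
  rewrite -inner_norm (rcE (ltW d0)) -[X in rc X]sqr_sqrtr ?res_ge0 ?ltW//.
  by rewrite rmorphXn/= ltr_pXn2r ?nnegrE ?(ltW sd).
suff -> : residual id e (\max_(j < N) (l j).+1) (u n) = 0 by rewrite inner0l.
apply/eqP; rewrite subr_eq0 {1}uE; apply/eqP.
under [RHS]eq_bigr => i _ do rewrite uE inner_suml scaler_suml.
rewrite [RHS]exchange_big/=; apply: eq_bigr => j _; rewrite -ls.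
have lj : (l j < \max_(j < N) (l j).+1)%N.
  exact: (@leq_bigmax _ (fun j => (l j).+1) j).
rewrite (bigD1 (Ordinal lj))//= big1 ?addr0 => [|i il]; rewrite innerZl.
  by case: (oe.1 (l j)) => ->; rewrite ?scaler0// mulr1.
by rewrite eo ?mulr0 ?scale0r// eq_sym.
Qed.

Lemma orthonormal_basis_bessel e x n : orthonormal_basis e ->
  \sum_(i < n) `|inner Q x (e i)| ^+ 2 <= `|x| ^+ 2.
Proof.
case=> e01 eo De; rewrite inner_norm; apply: (bessel id_nonneg_operator).
split=> // i; case: (e01 i); first by left.
by move=> e1; right; rewrite -inner_norm e1 expr1n.
Qed.

Lemma traceE (B : Q -> Q) (t : F) :
  (forall e, orthonormal_basis e -> trace_series B e @ \oo --> t) ->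
  trace B = t.
Proof.
move=> Bt; apply: xget_unique => //= s Bs.
have [e oe] := orthonormal_basis_exists.
exact: (scalar_cvg_unique (Bs e oe) (Bt e oe)).
Qed.

(** The default value of [trace] is [0], so a nonzero trace certifies convergence in every basis. *)
Lemma trace_neq0_cvg (B : Q -> Q) : trace B != 0 ->
  forall e, orthonormal_basis e -> trace_series B e @ \oo --> trace B.
Proof.
by rewrite /trace; case: xgetP => [t -> Bt _ e /Bt//|_ /eqP].
Qed.

End NonnegOperators.

(** * Rank-one decomposition of a density operator *)

Section TraceDecomposition.
Context {R : realType} {k : scalar_kind} {Q : hilbertType R k}.
Local Notation F := (scalars R k).
Hypothesis sepQ : separable_space Q.

(** Interchange of two limits: the error [c m] is uniform in [i]. *)
Lemma cvg_interchange (t : nat -> F) (s : nat -> nat -> F) (l c : nat -> F)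
    (L : F) :
  (forall i m, `|t i - s m i| <= c m) -> c @ \oo --> (0 : F) ->
  (forall m, s m @ \oo --> l m) -> l @ \oo --> L -> t @ \oo --> L.
Proof.
move=> tsc /cvgrPdist_lt c0 sl /cvgrPdist_lt lL; apply/cvgrPdist_lt => e e0.
have e3 : 0 < e / 3 by rewrite divr_gt0.
have [m] : exists m, `|0 - c m| < e / 3 /\ `|L - l m| < e / 3.
  have [m _ cm] := c0 _ e3; have [n _ ln] := lL _ e3.
  exists (maxn m n); split; first by apply: cm; exact: leq_maxl.
  by apply: ln; exact: leq_maxr.
rewrite sub0r normrN => -[cm lm].
have /cvgrPdist_lt /(_ _ e3) := sl m; apply: filterS => i sli.
have -> : L - t i = (L - l m) + (l m - s m i) + - (t i - s m i) by ring.
have -> : e = e / 3 + e / 3 + e / 3 by field.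
apply: le_lt_trans (ler_normD _ _) _; rewrite ltr_leD//.
  by apply: le_lt_trans (ler_normD _ _) _; rewrite ltrD.
rewrite normrN (le_trans (tsc _ _))//.
by apply: le_trans (ltW cm); apply: real_ler_norm; exact/ger0_real/le_trans/tsc.
Qed.

Variables (rho : Q -> Q).
Hypothesis rho_nonneg : nonneg_operator rho.
Hypothesis rho_trace : trace rho = 1.

Section Decomposition.
Variables (f : nat -> Q) (of_ : orthosystem rho f).
Hypothesis f_complete : forall x,
  (fun n => inner Q (rho (residual rho f n x)) (residual rho f n x)) @ \oo -->
  (0 : F).
(** Since [<rho x, f n> = <x, v n>], Parseval for the complete [rho]-orthonormal system [f] reads
    [<rho x, x> = \sum_n |<x, v n>|^2]. *)
Let v n := rho (f n).

Let inner_v x n : inner Q (rho x) (f n) = inner Q x (v n).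
Proof. exact: nonneg_operator_sym. Qed.

Let rest m x := inner Q (rho (residual rho f m x)) (residual rho f m x).

Let rest_ge0 m x : 0 <= rest m x.
Proof. exact: nonneg_operator_ge0. Qed.

Let restE m x : rest m x =
  inner Q (rho x) x - \sum_(n < m) `|inner Q x (v n)| ^+ 2.
Proof.
rewrite /rest residual_sqr//; congr (_ - _).
by apply: eq_bigr => n _; rewrite inner_v.
Qed.

Let sum_norm_le m : \sum_(n < m) `|v n| ^+ 2 <= 1.
Proof.
have [e oe] := orthonormal_basis_exists sepQ.
have te : trace_series rho e @ \oo --> (1 : F).
  by rewrite -rho_trace; apply: trace_neq0_cvg => //; rewrite rho_trace oner_neq0.
have vc : (fun K => \sum_(n < m) inner Q (\sum_(i < K) inner Q (v n) (e i) *: e i) (v n))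
    @ \oo --> \sum_(n < m) `|v n| ^+ 2.
  apply: sum_cvg => n; rewrite inner_norm; apply: inner_cvg.
  exact: orthonormal_basis_cvg.
apply: (cvg_scalar_le vc te) => K; rewrite /trace_series.
under eq_bigr do rewrite inner_suml.
rewrite exchange_big/=; apply: ler_sum => i _.
(* Bessel for [f] at each basis vector: the partial sum of rank-one operators lies below [rho], so
   its trace is at most [1]. *)
rewrite -subr_ge0 (_ : _ - _ = rest m (e i)) ?rest_ge0//.
rewrite restE; congr (_ - _); apply: eq_bigr => n _.
by rewrite innerZl (innerC (v n)) mulrC mul_conjs.
Qed.

Let norm_series_cvg : exists s : F,
  (fun m => \sum_(n < m) `|v n| ^+ 2) @ \oo --> s.
Proof.
apply/cvg_ex; apply: (nonneg_series_cvg (a := fun n => `|v n| ^+ 2) (M := 1)).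
  by move=> n; rewrite exprn_ge0.
exact: sum_norm_le.
Qed.

(** In a basis [e], replace [rho] by its [m]-th partial sum: the error is a mixed term in the
    residuals of [N (e i)] and [e i], and its sum over [i] is controlled by the tail of
    [\sum_n |v n|^2], uniformly in the number of basis vectors. The two limits can then be
    exchanged. *)
Lemma trace_mul_cvg (N : Q -> Q) : nonneg_operator N ->
  (fun m => \sum_(n < m) inner Q (N (v n)) (v n)) @ \oo --> trace (rho \o N).
Proof.
move=> N0; have [M M0 NM] := bounded_operator_pos (let: And3 b _ _ := N0 in b).
have : cvgn (fun m => \sum_(n < m) inner Q (N (v n)) (v n)).
  apply: (nonneg_series_cvg (a := fun n => inner Q (N (v n)) (v n))
    (M := rc M)).
    by move=> n; exact: nonneg_operator_ge0.
  move=> m; rewrite -[leRHS]mulr1.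
  apply: (@le_trans _ _ (rc M * \sum_(n < m) `|v n| ^+ 2)).
    rewrite mulr_sumr; apply: ler_sum => n _.
    apply: le_trans (real_ler_norm (ger0_real (nonneg_operator_ge0 N0 _))) _.
    apply: le_trans (cauchy_schwarz _ _) _.
    by rewrite expr2 mulrA ler_wpM2r.
  by rewrite ler_wpM2l ?rc_ge0.
move=> /cvg_ex[L NL].
suff -> : trace (rho \o N) = L by [].
apply: (traceE sepQ) => e oe.
have [s vs] := norm_series_cvg.
pose a m := \sum_(n < m) `|v n| ^+ 2.
have a_mono m m' : (m <= m')%N ->
    a m' - a m = \sum_(m <= n < m') `|v n| ^+ 2.
  move=> mm; rewrite /a -!(big_mkord predT (fun n => `|v n| ^+ 2)).
  by rewrite (@big_cat_nat _ _ _ m 0 m')//= addrAC subrr add0r.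
have as_ m : a m <= s.
  apply: (cvg_scalar_le (G := \oo) (u := fun=> a m)
    (v := fun n => a (n + m)%N) (cvg_cst _)).
    by have := vs; rewrite -(cvg_shiftn m).
  by move=> n; rewrite -subr_ge0 a_mono ?leq_addl// sumr_ge0.
(* [rest m] is the Parseval tail from [m] on; after exchanging sums, Bessel in the basis [e] bounds
   the sum over [i] by [|T (v n)|^2]. *)
have rest_sum m K (T : Q -> Q) (C : R) :
    (forall x y, inner Q (T x) y = inner Q x (T y)) ->
    (forall x, `|T x| <= rc C * `|x|) -> 0 <= C ->
    \sum_(i < K) rest m (T (e i)) <= rc C ^+ 2 * (s - a m).
  move=> Tsym TC C0.
  have cv : (fun m' => \sum_(i < K) (rest m (T (e i)) - rest (m' + m) (T (e i)))) @ \oo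
      --> \sum_(i < K) rest m (T (e i)).
    apply: sum_cvg => i; rewrite -[X in _ --> X]subr0.
    apply: cvgB; first exact: cvg_cst.
    by have := f_complete (T (e i)); rewrite -(cvg_shiftn m).
  apply: (cvg_scalar_le cv (cvg_cst _)) => m'.
  apply: (@le_trans _ _ (rc C ^+ 2 * (a (m' + m)%N - a m))); last first.
    by rewrite ler_wpM2l ?exprn_ge0 ?rc_ge0// lerD2r.
  rewrite a_mono ?leq_addl// mulr_sumr.
  under eq_bigr => i _.
    rewrite !restE opprB addrCA addrAC subrr add0r.
    rewrite -!(big_mkord predT (fun n => `|inner Q (T (e i)) (v n)| ^+ 2)).
    rewrite (@big_cat_nat _ _ _ m 0 (m' + m))//= ?leq_addl// addrAC subrr add0r.
    over.
  rewrite exchange_big/=; apply: ler_sum => n _.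
  apply: (@le_trans _ _ (`|T (v n)| ^+ 2)).
    apply: le_trans (orthonormal_basis_bessel (T (v n)) K oe).
    apply: ler_sum => i _; rewrite Tsym (innerC (e i)) norm_conjs.
    exact: lexx.
  by rewrite -exprMn ler_pXn2r ?nnegrE ?mulr_ge0 ?rc_ge0.
apply: (@cvg_interchange _ (fun m K => \sum_(n < m)
    inner Q (\sum_(i < K) inner Q (v n) (e i) *: e i) (N (v n)))
  (fun m => \sum_(n < m) inner Q (N (v n)) (v n))
  (fun m => 2^-1 * ((rc M ^+ 2 + 1) * (s - a m)))); last exact: NL.
- move=> K m; rewrite /trace_series.
  under [X in _ - X]eq_bigr do rewrite inner_suml.
  rewrite exchange_big/= -sumrB; apply: le_trans (ler_norm_sum _ _ _) _.
  apply: (@le_trans _ _ (\sum_(i < K) 2^-1 * (rest m (N (e i)) + rest m (e i)))).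
    apply: ler_sum => i _.
    have -> : inner Q ((rho \o N) (e i)) (e i) -
        \sum_(n < m) inner Q (inner Q (v n) (e i) *: e i) (N (v n)) =
        inner Q (rho (residual rho f m (N (e i)))) (residual rho f m (e i)).
      rewrite inner_residual2// inner_residual//; congr (_ - _).
      apply: eq_bigr => n _.
      by rewrite innerZl inner_v -/(v n) -(nonneg_operator_sym N0) mulrC.
    exact: nonneg_operator_mean.
  rewrite -mulr_sumr ler_wpM2l ?invr_ge0// big_split/= mulrDl lerD//.
    by apply: rest_sum => // x y; exact: nonneg_operator_sym.
  (* The summand [1] of the constant is the case [T = id], [C = 1]. *)
  rewrite -(expr1n _ 2) -(rmorph1 rc); apply: (rest_sum m K id) => // x.
  by rewrite rmorph1 mul1r.
- rewrite [X in _ --> X](_ : _ = 2^-1 * ((rc M ^+ 2 + 1) * (s - s))); last first.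
    by rewrite subrr !mulr0.
  by do 2 apply: cvgMr; apply: cvgB; [exact: cvg_cst|exact: vs].
- move=> m; apply: sum_cvg => n; rewrite (nonneg_operator_sym N0).
  by apply: inner_cvg; exact: orthonormal_basis_cvg.
Qed.

End Decomposition.

(* [rho] is the sum of the rank-one operators given by the [v n]; this replaces
   the spectral decomposition. *)
Lemma trace_decomposition : exists v : nat -> Q,
  forall N : Q -> Q, nonneg_operator N ->
  (fun m => \sum_(n < m) inner Q (N (v n)) (v n)) @ \oo --> trace (rho \o N).
Proof.
have [f [of_ fc]] := complete_orthosystem sepQ rho_nonneg.
by exists (fun n => rho (f n)) => N N0; exact: trace_mul_cvg.
Qed.

End TraceDecomposition.

Section PureStates.
Context {R : realType} {k : scalar_kind} {Q : hilbertType R k}.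
Local Notation F := (scalars R k).
Hypothesis sepQ : separable_space Q.
Variables (phi : Q) (phi1 : `|phi| = 1).

Definition pure_state (x : Q) : Q := inner Q x phi *: phi.

Lemma pure_state_nonneg : nonneg_operator pure_state.
Proof.
split.
- split; first by move=> a x y; rewrite /pure_state innerDl innerZl scalerDl scalerA.
  exists 1 => x; rewrite /pure_state normrZ phi1 mulr1 mul1r.
  by apply: le_trans (cauchy_schwarz _ _) _; rewrite phi1 mulr1.
- move=> x y; rewrite /pure_state innerZl innerZr (innerC phi y).
  by rewrite mulrC.
- move=> x; rewrite /pure_state innerZl (innerC phi) mul_conjs.
  by rewrite exprn_ge0.
Qed.

Lemma pure_state_trace_cvg (N : Q -> Q) (e : nat -> Q) : nonneg_operator N ->
  orthonormal_basis e ->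
  trace_series (pure_state \o N) e @ \oo --> inner Q (N phi) phi.
Proof.
move=> N0 oe; have := inner_cvg (y := N phi) (orthonormal_basis_cvg (x := phi) oe).
rewrite -(nonneg_operator_sym N0).
suff -> : trace_series (pure_state \o N) e =
  fun n => inner Q (\sum_(i < n) inner Q phi (e i) *: e i) (N phi) by [].
apply/funext => n; rewrite inner_suml; apply: eq_bigr => i _.
by rewrite /= /pure_state !innerZl (nonneg_operator_sym N0) mulrC.
Qed.

Lemma pure_state_trace (N : Q -> Q) : nonneg_operator N ->
  trace (pure_state \o N) = inner Q (N phi) phi.
Proof. by move=> N0; apply: (traceE sepQ) => e; exact: pure_state_trace_cvg. Qed.

Lemma pure_state_density : density_operator pure_state.
Proof.
have idQ := @id_nonneg_operator R k Q.
split; first exact: pure_state_nonneg.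
- split; first by case: pure_state_nonneg.
  (* A nonnegative operator is its own absolute value. *)
  exists pure_state; split=> //; first exact: pure_state_nonneg.
  have [e oe] := orthonormal_basis_exists sepQ; exists e => //.
  by apply/cvg_ex; eexists; exact: (pure_state_trace_cvg idQ oe).
- by rewrite (pure_state_trace idQ) -inner_norm phi1 expr1n.
Qed.

End PureStates.

(** * Quantum covariance embeddings *)

Section Polarization.
Context {R : realType} {k : scalar_kind} {Q : hilbertType R k}.
Local Notation F := (scalars R k).

Lemma mulr4n_inj (a b : F) : a *+ 4 = b *+ 4 -> a = b.
Proof.
rewrite -[LHS]mulr_natr -[RHS]mulr_natr; apply: mulIf.
by rewrite pnatr_eq0.
Qed.

(** Over the reals [imag_unit] is [0], and the identity rests on the symmetry of [A]. *)
Lemma polarization (A : Q -> Q) (x y : Q) : nonneg_operator A ->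
  inner Q (A x) y *+ 4 =
  inner Q (A (x + y)) (x + y) - inner Q (A (x - y)) (x - y) +
  imag_unit * (inner Q (A (x + imag_unit *: y)) (x + imag_unit *: y) -
               inner Q (A (x - imag_unit *: y)) (x - imag_unit *: y)).
Proof.
move=> A0; have pq (a : F) : inner Q (A (x + a *: y)) (x + a *: y) -
      inner Q (A (x - a *: y)) (x - a *: y) =
    (conjs a * inner Q (A x) y + a * conjs (inner Q (A x) y)) *+ 2.
  rewrite (nonneg_operatorD A0) (nonneg_operatorB A0) (nonneg_operatorZ A0).
  rewrite !innerDl innerNl !innerDr !innerNr !innerZl !innerZr.
  rewrite (nonneg_operatorC A0 x y); ring.
have := pq 1; rewrite !scale1r rmorph1 !mul1r => ->.
by rewrite pq mulrnAr -mulrnDl polarization_scalar -mulrnA.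
Qed.

Lemma nonneg_operator_ext (A B : Q -> Q) :
  nonneg_operator A -> nonneg_operator B ->
  (forall x, inner Q (A x) x = inner Q (B x) x) -> A = B.
Proof.
move=> A0 B0 AB; apply/funext => x; apply/eqP; rewrite -subr_eq0; apply/eqP.
apply: inner_eq0; rewrite innerBl; apply/eqP; rewrite subr_eq0; apply/eqP.
by apply: mulr4n_inj; rewrite !polarization// !AB.
Qed.

End Polarization.

Arguments povm_integral_cvg {R k X Q} nu x y {h} _.
Arguments measure_integral_cvg {R k X P m h} _ _.

Section PovmIntegral.
Context {R : realType} {k : scalar_kind} {X : ptopologicalType}.
Context {Q : hilbertType R k}.
Local Notation F := (scalars R k).
Implicit Types (mu nu : povm X Q) (x y : Q).

Lemma eq_riemann_limit d (T : measurableType d)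
    (u v : @tagged_partition d T -> F) (l m : F) : u =1 v ->
  u @ fine_partitions --> l -> v @ fine_partitions --> m -> l = m.
Proof. by move=> /funext-> vl /(scalar_cvg_unique vl). Qed.

Lemma povm_integral_polarization mu nu (h : borel X -> F) :
  bounded_measurable h ->
  (forall x, povm_integral mu x x h = povm_integral nu x x h) ->
  forall x y, povm_integral mu x y h = povm_integral nu x y h.
Proof.
move=> bh mn x y.
suff pol (la : povm X Q) : povm_integral la x y h *+ 4 =
    povm_integral la (x + y) (x + y) h - povm_integral la (x - y) (x - y) h +
    imag_unit * (povm_integral la (x + imag_unit *: y) (x + imag_unit *: y) h -
                 povm_integral la (x - imag_unit *: y) (x - imag_unit *: y) h).
  by apply: mulr4n_inj; rewrite !pol !mn.
pose S u v := riemann_sum (fun t B => h t * inner Q (la B u) v).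
have Sc u v : S u v @ fine_partitions --> povm_integral la u v h.
  exact: povm_integral_cvg.
apply: (scalar_cvg_unique (G := fine_partitions) (u := fun P => S x y P *+ 4)).
  exact: cvgMn (Sc x y).
rewrite [X in X @ _](_ : _ = fun P => S (x + y) (x + y) P - S (x - y) (x - y) P +
    imag_unit * (S (x + imag_unit *: y) (x + imag_unit *: y) P -
                 S (x - imag_unit *: y) (x - imag_unit *: y) P)).
  by apply: cvgD; [|apply: cvgMr]; apply: cvgB; exact: Sc.
apply/funext => P; rewrite /S /riemann_sum -sumrMnl -!sumrB mulr_sumr.
rewrite -big_split/=; apply: eq_bigr => c _.
rewrite -mulrnAr polarization; last exact/povm_nonneg/cell_of_measurable.
ring.
Qed.

Lemma povm_integral_scale nu (a : F) x (h : borel X -> F) :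
  bounded_measurable h ->
  povm_integral nu (a *: x) (a *: x) h = a * conjs a * povm_integral nu x x h.
Proof.
move=> bh; apply: eq_riemann_limit (povm_integral_cvg nu (a *: x) (a *: x) bh)
  (cvgMr (a := a * conjs a) (povm_integral_cvg nu x x bh)) => P.
rewrite /riemann_sum mulr_sumr; apply: eq_bigr => c _.
rewrite (nonneg_operatorZ (povm_nonneg _ _)); last exact: cell_of_measurable.
rewrite innerZl innerZr; ring.
Qed.

(** The absolute value changes nothing on Borel sets; it secures nonnegativity on the other sets,
    where [nu B] is arbitrary. *)
Definition diag_measure nu x (B : set (borel X)) : \bar R :=
  (`|res (inner Q (nu B x) x)|)%:E.

Lemma diag_measureE nu x B : measurable B ->
  diag_measure nu x B = (res (inner Q (nu B x) x))%:E.
Proof.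
move=> mB; rewrite /diag_measure ger0_norm//; apply: res_ge0.
exact/nonneg_operator_ge0/povm_nonneg.
Qed.

Section DiagMeasure.
Variables (nu : povm X Q) (x : Q).

Let diag0 : diag_measure nu x set0 = 0%E.
Proof. by rewrite /diag_measure povm_set0 inner0l res0 normr0. Qed.

Let diag_ge0 B : (0 <= diag_measure nu x B)%E.
Proof. by rewrite lee_fin. Qed.

Let diag_sigma_additive : semi_sigma_additive (diag_measure nu x).
Proof.
move=> B mB tB mU; rewrite diag_measureE//.
under eq_fun do under eq_bigr do rewrite diag_measureE//.
exact: (@charge_semi_sigma_additive _ _ _ (povm_re nu x x)).
Qed.

HB.instance Definition _ := isMeasure.Build _ _ _ (diag_measure nu x)
  diag0 diag_ge0 diag_sigma_additive.

Let diag_fin : fin_num_fun (diag_measure nu x).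
Proof. by []. Qed.

HB.instance Definition _ := @Measure_isFinite.Build _ _ _
  (diag_measure nu x) diag_fin.

Lemma diag_measure_setT : diag_measure nu x setT = (nr x ^+ 2)%:E.
Proof. by rewrite diag_measureE// povm_setT nr_sqr. Qed.

End DiagMeasure.

Lemma diag_measure_integral nu x (P : set (borel X) -> \bar R)
    (h : borel X -> F) : bounded_measurable h ->
  (forall B, measurable B -> P B = diag_measure nu x B) ->
  measure_integral P h = povm_integral nu x x h.
Proof.
move=> bh PE.
apply: eq_riemann_limit (measure_integral_cvg PE bh)
  (povm_integral_cvg nu x x bh) => S.
rewrite /riemann_sum; apply: eq_bigr => c _; congr (_ * _).
have mc : measurable (cell_of S @^-1` [set c]) by exact: cell_of_measurable.
rewrite [RHS]rcE; last exact/nonneg_operator_ge0/povm_nonneg.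
by congr rc; exact: (congr1 fine (diag_measureE nu x mc)).
Qed.

Lemma povm_extensional mu nu B : measurable B ->
  (forall x, diag_measure mu x B = diag_measure nu x B) -> mu B = nu B.
Proof.
move=> mB mn; have mB0 := povm_nonneg mu mB; have nB0 := povm_nonneg nu mB.
apply: nonneg_operator_ext => // x.
have := mn x; rewrite !diag_measureE// => -[e].
by rewrite (rcE (nonneg_operator_ge0 mB0 x)) e -rcE// nonneg_operator_ge0.
Qed.

(** For [x = 0] the unit vector has to come from elsewhere; this is where [Q] must be nonzero. *)
Lemma unit_multiple x : (exists z : Q, z != 0) ->
  exists (a : F) (phi : Q), `|phi| = 1 /\ x = a *: phi.
Proof.
have nz (z : Q) : z != 0 -> exists (a : F) (phi : Q), `|phi| = 1 /\ z = a *: phi.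
  move=> z0; exists `|z|, (`|z|^-1 *: z).
  rewrite normrZ normfV normr_id mulVf ?normr_eq0//.
  by rewrite scalerA divff ?normr_eq0// scale1r.
move=> [z z0]; have [->|x0] := eqVneq x 0; last exact: nz.
have [_ [phi [phi1 _]]] := nz z z0.
by exists 0, phi; rewrite scale0r.
Qed.

Section InducedMeasure.
Hypothesis sepQ : separable_space Q.

Lemma induced_measure_pure nu phi B : `|phi| = 1 -> measurable B ->
  induced_measure nu (pure_state phi) B = diag_measure nu phi B.
Proof.
move=> phi1 mB; rewrite diag_measureE// /induced_measure pure_state_trace//.
exact: povm_nonneg.
Qed.

(** The sequence [v] depends on [rho] alone, so it serves both POVMs under comparison. *)
Lemma induced_measure_mseries rho : nonneg_operator rho -> trace rho = 1 ->
  exists v : nat -> Q, forall nu B, measurable B ->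
    induced_measure nu rho B = mseries (fun n => diag_measure nu (v n)) 0 B.
Proof.
move=> rho0 rho1; have [v vN] := trace_decomposition sepQ rho0 rho1.
exists v => nu B mB; have nB := povm_nonneg nu mB.
apply/esym/cvg_lim => //; rewrite /induced_measure.
suff -> : (fun n => \sum_(0 <= i < n) diag_measure nu (v i) B)%E =
    fun n => (res (\sum_(i < n) inner Q (nu B (v i)) (v i)))%:E.
  by apply: cvg_EFin; [exact: nearW|exact: res_cvg (vN _ nB)].
apply/funext => n; rewrite big_mkord raddf_sum -sumEFin.
by apply: eq_bigr => i _; rewrite diag_measureE.
Qed.

Lemma induced_measure_integral mu nu rho (h : borel X -> F) :
  nonneg_operator rho -> trace rho = 1 -> bounded_measurable h ->
  (forall x, povm_integral mu x x h = povm_integral nu x x h) ->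
  measure_integral (induced_measure mu rho) h =
  measure_integral (induced_measure nu rho) h.
Proof.
move=> rho0 rho1 bh mn.
have [v vE] := induced_measure_mseries rho0 rho1.
(* Total mass [Tr rho = 1] makes bounded functions integrable for the series of measures. *)
have tr1 (la : povm X Q) : mseries (fun n => diag_measure la (v n)) 0 setT = 1%E.
  rewrite -vE// /induced_measure (_ : rho \o _ = rho) ?rho1.
    by rewrite -(rmorph1 rc) rcK.
  by apply/funext => x /=; rewrite povm_setT.
have int (la : povm X Q) (g : borel X -> R) (M : R) :
    measurable_fun setT g -> (forall t, `|g t| <= M) ->
    integral (induced_measure la rho) setT (EFin \o g) =
    (\sum_(n <oo) integral (diag_measure la (v n)) setT (EFin \o g))%E.
  move=> mg gM; rewrite (eq_integral_on_measurable (vE la)).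
  have ig : (mseries (fun n => diag_measure la (v n)) 0).-integrable setT (EFin \o g).
    apply: measurable_bounded_integrable => //.
      by have := ltry (1 : R); rewrite -(tr1 la).
    exists M; split; first exact: num_real.
    by move=> y /ltW My t _ /=; exact: le_trans (gM t) My.
  have mE : measurable_fun setT (EFin \o g) by exact/measurable_EFinP.
  (* Summability for the positive and negative parts, required to integrate term by term. *)
  have fin (f : borel X -> \bar R) : measurable_fun setT f ->
      (forall t, 0 <= f t)%E ->
      (mseries (fun n => diag_measure la (v n)) 0).-integrable setT f ->
      (\sum_(n <oo) `|integral (diag_measure la (v n)) setT f| < +oo)%E.
    move=> mf f0 /integrableP[_].
    under eq_integral do rewrite gee0_abs//.
    rewrite ge0_integral_measure_series//; apply: le_lt_trans.
    rewrite le_eqVlt; apply/orP; left; apply/eqP; apply: eq_eseriesr => n _.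
    by rewrite gee0_abs// integral_ge0.
  rewrite integral_measure_series//.
  - by move=> n; apply: bounded_measurable_integrable gM.
  - apply: fin; [exact: measurable_funeneg| |exact: integrable_funeneg].
    by move=> t; exact: funeneg_ge0.
  - apply: fin; [exact: measurable_funepos| |exact: integrable_funepos].
    by move=> t; exact: funepos_ge0.
have [M [rM iM]] := bounded_parts bh; case: (bh) => _ rh ih.
have diag_eq n : measure_integral (diag_measure mu (v n)) h =
    measure_integral (diag_measure nu (v n)) h.
  by rewrite !(diag_measure_integral (x := v n) bh (fun _ _ => erefl)).
have fineE (la : povm X Q) n (g : borel X -> R) : measurable_fun setT g ->
    (forall t, `|g t| <= M) ->
    integral (diag_measure la (v n)) setT (EFin \o g) \is a fin_num.
  move=> mg gM; apply: integrable_fin_num => //.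
  exact: bounded_measurable_integrable gM.
rewrite /measure_integral !(int _ _ _ rh rM) !(int _ _ _ ih iM).
congr (mks (fine _) (fine _)); apply: eq_eseriesr => n _.
  rewrite -[LHS]fineK ?fineE// -[RHS]fineK ?fineE//; congr (_%:E).
  by have := congr1 res (diag_eq n); rewrite /measure_integral !res_mks.
(* Over the reals [mks] drops its second argument, so [diag_eq] says nothing about imaginary parts;
   but these are then zero. *)
have [imsE|ims0] : (forall a b, ims (mks a b : F) = b) \/ (forall z : F, ims z = 0).
  by rewrite /ims /mks; case: k; [right|left].
  rewrite -[LHS]fineK ?fineE// -[RHS]fineK ?fineE//; congr (_%:E).
  by have := congr1 ims (diag_eq n); rewrite /measure_integral !imsE.
rewrite (_ : ims \o h = cst 0); last by apply/funext => t; exact: ims0.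
by rewrite (_ : EFin \o _ = cst 0%E)// !integral0.
Qed.

End InducedMeasure.

Section ScalarPovm.
Variable P : probability (borel X) R.

Definition scalar_povm_op (B : set (borel X)) (x : Q) : Q :=
  rc (fine (P B)) *: x.

Fact scalar_povm_nonneg B : measurable B -> nonneg_operator (scalar_povm_op B).
Proof.
move=> mB; have P0 : 0 <= fine (P B) by exact: fine_ge0.
split.
- split; first by move=> a x y; rewrite /scalar_povm_op scalerDr !scalerA mulrC.
  by exists (rc (fine (P B))) => x; rewrite normrZ norm_rc ger0_norm.
- by move=> x y; rewrite innerZl innerZr conjs_rc.
- by move=> x; rewrite innerZl mulr_ge0 ?rc_ge0 ?inner_ge0.
Qed.

Fact scalar_povm_set0 x : scalar_povm_op set0 x = 0.
Proof. by rewrite /scalar_povm_op measure0 rmorph0 scale0r. Qed.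

Fact scalar_povm_setT x : scalar_povm_op setT x = x.
Proof. by rewrite /scalar_povm_op probability_setT rmorph1 scale1r. Qed.

Fact scalar_povm_sigma_additive (B : nat -> set (borel X)) :
  (forall n, measurable (B n)) -> trivIset setT B ->
  forall x, (fun n => \sum_(i < n) scalar_povm_op (B i) x) @ \oo -->
            scalar_povm_op (\bigcup_n B n) x.
Proof.
move=> mB tB x.
rewrite [X in X @ _](_ : _ = fun n => rc (\sum_(i < n) fine (P (B i))) *: x).
  apply: cvgZr_tmp; apply: rc_cvg.
  have mU : measurable (\bigcup_n B n) by exact: bigcupT_measurable.
  have Pfin C : measurable C -> P C \is a fin_num by exact: fin_num_measure.
  suff -> : (fun n => \sum_(i < n) fine (P (B i))) =
      fine \o (fun n => \sum_(0 <= i < n) P (B i))%E.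
    apply: fine_cvg; rewrite fineK; last exact: Pfin.
    exact: (@measure_semi_sigma_additive _ _ _ P B mB tB mU).
  apply/funext => n; rewrite /= big_mkord sum_fine// => i _; exact: Pfin.
by apply/funext => n; rewrite rmorph_sum scaler_suml.
Qed.

Definition scalar_povm : povm X Q :=
  Povm scalar_povm_nonneg scalar_povm_set0 scalar_povm_setT
    scalar_povm_sigma_additive.

Lemma scalar_povm_integral x y (h : borel X -> F) : bounded_measurable h ->
  povm_integral scalar_povm x y h = measure_integral P h * inner Q x y.
Proof.
move=> bh; apply: eq_riemann_limit (povm_integral_cvg scalar_povm x y bh)
  (cvgMl (b := inner Q x y) (measure_integral_cvg (m := P) (fun _ _ => erefl) bh)) => S.
rewrite /riemann_sum mulr_suml; apply: eq_bigr => c _.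
by rewrite /= /scalar_povm_op innerZl mulrA.
Qed.

End ScalarPovm.
End PovmIntegral.

(** * Existence of the embeddings and comparison through integrals *)

Section Embeddings.
Context {R : realType} {k : scalar_kind} {X : ptopologicalType}.
Local Notation F := (scalars R k).
Context {K : X -> X -> F} (C0K : C0_kernel K) (H : rkhs K).

Lemma qce_exists (Q : hilbertType R k) (HQ : hilbert_tensor H Q)
  (nu : povm X Q) : is_qce nu (qce HQ nu).
Proof.
pose tau (p : H * Q) := tensor HQ p.1 p.2.
have [||||||T bT TE] := @operator_of_integral _ _ _ _ _ C0K HQ Q tau
  (fun B x y => inner Q (nu B x) y) (fun x y => inner Q x y)
  (fun p q => povm_integral nu p.2 q.2 (Defs.fprod p.1 q.1)).
- exact: tensor_dense.
- by move=> p q; exact: tensor_inner.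
- move=> B y z mB; apply: nonneg_operatorC; exact: povm_nonneg.
- move=> B s mB; have B0 := povm_nonneg nu mB.
  (* The form of [nu B] on a formal combination is [<nu(B) u, u>], with [u] its sum in [Q]. *)
  have -> : form_on (fun x y => inner Q (nu B x) y) s s =
      inner Q (nu B (combination id s)) (combination id s).
    rewrite /form_on (nonneg_operator_sum B0) inner_suml.
    apply: eq_bigr => p _; rewrite inner_sumr; apply: eq_bigr => q _.
    by rewrite (nonneg_operatorZ B0) innerZl innerZr mulrA.
  exact: nonneg_operator_ge0.
- by move=> P y z; exact: povm_partition_sum.
- by move=> p q; apply: povm_integral_cvg; exact: fprod_bounded_measurable.
have TT : is_qce nu T by split => // f g x y; exact: (TE (f, x) (g, y)).
by rewrite /qce; case: xgetP => [S _ //|/(_ T)].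
Qed.

(** [P] is tied to a measure [m] only on Borel sets, so that the statement applies to
    [induced_measure]. *)
Lemma qce_prob_exists (P : set (borel X) -> \bar R)
    (m : {finite_measure set (borel X) -> \bar R}) :
  (forall B, measurable B -> P B = m B) -> m setT = 1%E ->
  is_qce_prob P (qce_prob H P).
Proof.
move=> Pm m1; pose tau (p : H * unit) := p.1.
have [||||||T bT TE] := @operator_of_integral _ _ _ _ _ C0K H unit tau
  (fun B _ _ => rc (fine (m B))) (fun _ _ => 1)
  (fun p q => measure_integral P (Defs.fprod p.1 q.1)).
- move=> O [f Of] _; exists f; split => //.
  exists 1%N, (fun=> 1), (fun=> f); split; last by rewrite big_ord1 scale1r.
  by move=> _; exists (f, tt).
- by move=> p q; rewrite mulr1.
- by move=> B y z mB; rewrite conjs_rc.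
- move=> B s mB; rewrite /form_on.
  have -> : \sum_(p <- s) \sum_(q <- s) p.1 * conjs q.1 * rc (fine (m B)) =
      (\sum_(p <- s) p.1) * conjs (\sum_(p <- s) p.1) * rc (fine (m B)).
    rewrite !mulr_suml; apply: eq_bigr => p _.
    by rewrite rmorph_sum mulr_sumr mulr_suml.
  by rewrite mul_conjs mulr_ge0 ?exprn_ge0// rc_ge0 fine_ge0.
- move=> S y z; have := congr1 (@rc R k) (measure_partition_sum m S).
  by rewrite m1 /riemann_sum rmorph_sum/= rmorph1.
- by move=> p q; apply: measure_integral_cvg => //; exact: fprod_bounded_measurable.
have TT : is_qce_prob P T by split => // f g; exact: (TE (f, tt) (g, tt)).
by rewrite /qce_prob; case: xgetP => [S _ //|/(_ T)].
Qed.

(** By polarization the predicates [is_qce mu] and [is_qce nu] coincide, and so do the choices made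
    from them. *)
Lemma eq_qce (Q : hilbertType R k) (HQ : hilbert_tensor H Q) (mu nu : povm X Q) :
  (forall (f g : H) x, povm_integral mu x x (Defs.fprod f g) =
                       povm_integral nu x x (Defs.fprod f g)) ->
  qce HQ mu = qce HQ nu.
Proof.
move=> mn; rewrite /qce; congr xget; apply/funext => T; apply/propext.
have {}mn (f g : H) x y : povm_integral mu x y (Defs.fprod f g) =
    povm_integral nu x y (Defs.fprod f g).
  by apply: povm_integral_polarization => //; exact: fprod_bounded_measurable.
by split=> -[bT TE]; split => // f g x y; rewrite TE mn.
Qed.

Lemma qce_inj (Q : hilbertType R k) (HQ : hilbert_tensor H Q) (mu nu : povm X Q) :
  qce HQ mu = qce HQ nu -> forall (f g : H) x,
  povm_integral mu x x (Defs.fprod f g) = povm_integral nu x x (Defs.fprod f g).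
Proof.
move=> mn f g x; have [_ <-] := qce_exists HQ mu.
by rewrite mn; have [_ <-] := qce_exists HQ nu.
Qed.

Lemma eq_qce_prob (P P' : set (borel X) -> \bar R) :
  (forall f g : H, measure_integral P (Defs.fprod f g) =
                   measure_integral P' (Defs.fprod f g)) ->
  qce_prob H P = qce_prob H P'.
Proof.
move=> PP; rewrite /qce_prob; congr xget; apply/funext => T; apply/propext.
by split=> -[bT TE]; split => // f g; rewrite TE PP.
Qed.

Lemma qce_prob_inj (P P' : set (borel X) -> \bar R)
    (m m' : {finite_measure set (borel X) -> \bar R}) :
  (forall B, measurable B -> P B = m B) -> m setT = 1%E ->
  (forall B, measurable B -> P' B = m' B) -> m' setT = 1%E ->
  qce_prob H P = qce_prob H P' -> forall f g : H,
  measure_integral P (Defs.fprod f g) = measure_integral P' (Defs.fprod f g).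
Proof.
move=> Pm m1 Pm' m1' PP f g; have [_ <-] := qce_prob_exists Pm m1.
by rewrite PP; have [_ <-] := qce_prob_exists Pm' m1'.
Qed.

End Embeddings.

Section DiagProbability.
Context {R : realType} {k : scalar_kind} {X : ptopologicalType}.
Context {Q : hilbertType R k} (nu : povm X Q) (phi : Q) (phi1 : `|phi| = 1).

(* A copy of [diag_measure nu phi] whose type records that [phi] is a unit
   vector, so that it can be made a probability. *)
Definition unit_diag_measure (_ : `|phi| = 1) := diag_measure nu phi.

HB.instance Definition _ := Measure.on (unit_diag_measure phi1).

Lemma unit_diag_measure_setT : unit_diag_measure phi1 setT = 1%E.
Proof.
by rewrite /unit_diag_measure diag_measure_setT /nr phi1 -(rmorph1 rc) rcK expr1n.
Qed.

HB.instance Definition _ := Measure_isProbability.Build _ _ _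
  (unit_diag_measure phi1) unit_diag_measure_setT.

End DiagProbability.

Theorem theorem3p6 (R : realType) (k : scalar_kind) (X : ptopologicalType)
    (lcX : locally_compact [set: X]) (hX : hausdorff_space X)
    (Q : hilbertType R k) (sepQ : separable_space Q)
    (Q_neq0 : exists x : Q, x != 0)
    (K : X -> X -> scalars R k) (C0K : C0_kernel K)
    (H : rkhs K) (sepH : separable_space H) (HQ : hilbert_tensor H Q) :
  (forall mu nu : povm X Q,
     qce HQ mu = qce HQ nu <->
     forall rho : Q -> Q, density_operator rho ->
       qce_prob H (induced_measure mu rho) =
       qce_prob H (induced_measure nu rho)) /\
  (characteristic_povm HQ <-> characteristic_prob H).
Proof.
have bh (f g : H) := fprod_bounded_measurable C0K f g.
split=> [mu nu|]; split.
- move=> mn rho [rho0 _ rho1]; apply: eq_qce_prob => f g.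
  apply: induced_measure_integral => // x; exact: qce_inj mn _ _ _.
- move=> mn; apply: eq_qce => // f g x.
  (* Reduce to a unit vector: its pure state is a density operator inducing [<nu(.) phi, phi>]. *)
  have [a [phi [phi1 ->]]] := unit_multiple x Q_neq0.
  rewrite !povm_integral_scale//; congr (_ * _).
  have indE (la : povm X Q) B : measurable B ->
      induced_measure la (pure_state phi) B = unit_diag_measure la phi1 B.
    exact: induced_measure_pure.
  rewrite -(diag_measure_integral (bh f g) (indE mu)).
  rewrite -(diag_measure_integral (bh f g) (indE nu)).
  apply: (qce_prob_inj C0K (indE mu) _ (indE nu)).
  + exact: unit_diag_measure_setT.
  + exact: unit_diag_measure_setT.
  + by apply: mn; exact: pure_state_density.
- move=> charK P P' PP B mB.
  (* The integrals of [P(.) I] are those of [P] times [<x, x>], so equal embeddings of [P] and [P']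
     lift to the POVMs. *)
  have QP : qce HQ (scalar_povm P) = qce HQ (scalar_povm P').
    apply: eq_qce => // f g x; rewrite !scalar_povm_integral//; congr (_ * _).
    by apply: (qce_prob_inj C0K (m := P) (m' := P')) => //; exact: probability_setT.
  have [z z0] := Q_neq0.
  have /(congr1 (fun T => T z)) := charK _ _ QP B mB.
  move=> /eqP; rewrite -subr_eq0 -scalerBl scaler_eq0 (negbTE z0) orbF.
  rewrite -rmorphB/= => /eqP/(congr1 res); rewrite rcK res0 => /eqP.
  rewrite subr_eq0 => /eqP e.
  by rewrite -[LHS]fineK ?fin_num_measure// e fineK ?fin_num_measure.
- move=> charK mu nu mn B mB; apply: povm_extensional => // x.
  have [a [phi [phi1 ->]]] := unit_multiple x Q_neq0.
  (* For a unit vector these are probabilities, and the diagonal part of the equality of the two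
     QCEs identifies their embeddings. *)
  have e : diag_measure mu phi B = diag_measure nu phi B.
    apply: (charK (unit_diag_measure mu phi1) (unit_diag_measure nu phi1)) => //.
    apply: eq_qce_prob => f g.
    rewrite !(diag_measure_integral (bh f g) (fun _ _ => erefl)).
    exact: qce_inj mn _ _ _.
  move: e; rewrite !diag_measureE// !(nonneg_operatorZ (povm_nonneg _ mB)).
  rewrite !innerZl !innerZr => -[e]; congr (_%:E).
  rewrite (rcE (nonneg_operator_ge0 (povm_nonneg mu mB) phi)) e -rcE//.
  exact/nonneg_operator_ge0/povm_nonneg.
Qed.
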